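(* Let $\sigma>1$. There exists a constant $C>0$ depending only on $\sigma$ such that the following holds. Consider any $K$-armed stochastic bandit ($K\in\mathbb{Z}_+$) whose reward distributions $P_1,\dots,P_K$ with means $\mu_1,\dots,\mu_K$ are 1-sub-Gaussian, i.e. $\mathbb{E}_{r\sim P_j}e^{\lambda(r-\mu_j)}\le e^{\lambda^2/2}$ for all $\lambda\in\mathbb{R}$ and $j\in[K]$. Run MINTS with the uniform prior over $[K]$, the Gaussian likelihood with parameter $\sigma$, and parameter space $\Theta=\mathbb{R}^K$. Then for every $T\in\mathbb{Z}_+$, $$\mathbb{E}[\mathrm{Regret}(T)]\le C\left(\min\left\{\sum_{j:\,\Delta_j>0}\frac{\log T}{\Delta_j},\ \sqrt{KT\log K}\right\}+\sum_{j=1}^K\Delta_j\right).$$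
   Context: Notation: $[K]=\{1,\dots,K\}$. Each arm $j\in[K]$ has a reward distribution $P_j$ on $\mathbb{R}$ with mean $\mu_j$; $\Delta_j=\max_{k\in[K]}\mu_k-\mu_j$ is its suboptimality gap. At each period $t=1,2,\dots$ the agent picks an arm $x_t\in[K]$ and receives feedback $\phi_t$, which conditionally on the past data and $x_t$ is drawn from $P_{x_t}$. The dataset is $\mathcal{D}_0=\varnothing$, $\mathcal{D}_t=\mathcal{D}_{t-1}\cup\{(x_t,\phi_t)\}$. The regret is $\mathrm{Regret}(T)=\sum_{t=1}^T\Delta_{x_t}$. MINTS (minimalist Thompson sampling) with prior $Q_0$ on $[K]$, Gaussian likelihood with parameter $\sigma>0$, and parameter space $\Theta\subseteq\mathbb{R}^K$: the likelihood is $$L(\theta;\mathcal{D}_t)=\prod_{i=1}^t\frac{1}{\sqrt{2\pi}\,\sigma}\exp\left(-\frac{(\theta_{x_i}-\phi_i)^2}{2\sigma^2}\right),\quad \theta\in\Theta.$$ For $j\in[K]$ let $\Theta_j=\{v\in\Theta: v_j\ge v_k\ \forall k\in[K]\}$ and define the profile likelihood $\bar L(j;\mathcal{D}_t)=\sup_{v\in\Theta_j}L(v;\mathcal{D}_t)$. The generalized posterior is $Q_t(j)=\bar L(j;\mathcal{D}_t)Q_0(j)\big/\sum_{k=1}^K\bar L(k;\mathcal{D}_t)Q_0(k)$. At each period $t$, conditionally on $\mathcal{D}_{t-1}$, the arm $x_t$ is sampled from $Q_{t-1}$. The Gaussian model only defines the algorithm; the true rewards need not be Gaussian. *)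

(* Defs.v *)
From HB Require Import structures.
From mathcomp Require Import all_boot all_order all_algebra.
From mathcomp Require Import all_classical all_reals all_analysis.
Import Order.TTheory GRing.Theory Num.Theory.
Import numFieldNormedType.Exports.

Set Implicit Arguments.
Unset Strict Implicit.
Unset Printing Implicit Defensive.

Local Open Scope classical_set_scope.
Local Open Scope ring_scope.

Section bandit.
Context {R : realType}.

(* Probability distributions on the Borel sigma-algebra of the real line. *)
Definition real_law := probability (measurableTypeR R) R.

Definition has_mean (nu : real_law) (m : R) : Prop :=
  nu.-integrable setT (EFin \o (fun r : R => r)) /\
  'E_nu[fun r : R => r]%E = m%:E.

Definition one_subgaussian (nu : real_law) (m : R) : Prop :=
  forall lam : R,
    ('E_nu[fun r : R => expR (lam * (r - m))] <= (expR (lam ^+ 2 / 2))%:E)%E.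

Section arms.
Context {K : nat}.

(* Starting the iterated maximum from [mu j], itself one of the terms, gives
   the plain maximum over all arms. *)
Definition gap (mu : 'I_K -> R) (j : 'I_K) : R :=
  \big[Num.max/mu j]_(k < K) mu k - mu j.

(* The dataset after t rounds, as the list (x_1, phi_1), ..., (x_t, phi_t), so
   that repeated observations are kept. *)
Definition dataset {Om : Type} (x : nat -> Om -> 'I_K) (phi : nat -> Om -> R)
    (t : nat) (w : Om) : seq ('I_K * R) :=
  [seq (x i w, phi i w) | i <- iota 1 t].

Definition likelihood (sigma : R) (v : 'rV[R]_K) (D : seq ('I_K * R)) : R :=
  \prod_(a <- D) ((Num.sqrt (2 * pi) * sigma)^-1 *
                  expR (- ((v ord0 a.1 - a.2) ^+ 2 / (2 * sigma ^+ 2)))).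

Definition argmax_set (Theta : set 'rV[R]_K) (j : 'I_K) : set 'rV[R]_K :=
  [set v | Theta v /\ forall k, v ord0 k <= v ord0 j].

Definition profile_likelihood (sigma : R) (Theta : set 'rV[R]_K) (j : 'I_K)
    (D : seq ('I_K * R)) : R :=
  sup [set likelihood sigma v D | v in argmax_set Theta j].

Definition gen_posterior (sigma : R) (Theta : set 'rV[R]_K) (Q0 : 'I_K -> R)
    (D : seq ('I_K * R)) (j : 'I_K) : R :=
  profile_likelihood sigma Theta j D * Q0 j /
  \sum_(k < K) profile_likelihood sigma Theta k D * Q0 k.

Definition uniform_prior (j : 'I_K) : R := K%:R^-1.

Definition regret {Om : Type} (mu : 'I_K -> R) (x : nat -> Om -> 'I_K)
    (T : nat) (w : Om) : R :=
  \sum_(1 <= t < T.+1) gap mu (x t w).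

(* Sigma-algebra generated by (x_1, phi_1), ..., (x_t, phi_t). *)
Definition sigma_data {Om : Type} (x : nat -> Om -> 'I_K)
    (phi : nat -> Om -> R) (t : nat) : set (set Om) :=
  <<s [set A | exists i, (1 <= i <= t)%N /\
        ((exists j : 'I_K, A = x i @^-1` [set j]) \/
         (exists2 B : set (measurableTypeR R),
            measurable B & A = phi i @^-1` B))] >>.

(* Sigma-algebra generated by (x_1, phi_1), ..., (x_t, phi_t) and x_{t+1}. *)
Definition sigma_data_arm {Om : Type} (x : nat -> Om -> 'I_K)
    (phi : nat -> Om -> R) (t : nat) : set (set Om) :=
  <<s sigma_data x phi t `|`
      [set A | exists j : 'I_K, A = x t.+1 @^-1` [set j]] >>.

(* A MINTS trajectory x_1, phi_1, x_2, phi_2, ... (values at index 0 are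
   unused).  The two conditional laws are stated by the defining property of a
   regular conditional distribution: P(A, Y in B) = E[1_A kappa(B)] for every
   event A of the conditioning sigma-algebra. *)
Record mints_run (sigma : R) (Theta : set 'rV[R]_K) (Q0 : 'I_K -> R)
    (nu : 'I_K -> real_law)
    (d : measure_display) (Om : measurableType d) (P : probability Om R)
    (x : nat -> Om -> 'I_K) (phi : nat -> Om -> R) : Prop := MintsRun {
  mints_measurable_arm : forall (t : nat) (j : 'I_K),
    measurable (x t.+1 @^-1` [set j]) ;
  mints_measurable_feedback : forall t : nat,
    measurable_fun setT (phi t.+1 : Om -> measurableTypeR R) ;
  mints_arm_law : forall (t : nat) (j : 'I_K) (A : set Om),
    sigma_data x phi t A ->
    P (A `&` x t.+1 @^-1` [set j]) =
    (\int[P]_(w in A)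
       (gen_posterior sigma Theta Q0 (dataset x phi t w) j)%:E)%E ;
  mints_feedback_law : forall (t : nat) (B : set (measurableTypeR R))
      (A : set Om),
    measurable B -> sigma_data_arm x phi t A ->
    P (A `&` phi t.+1 @^-1` B) = (\int[P]_(w in A) nu (x t.+1 w) B)%E
}.

End arms.
End bandit.

Arguments real_law R : clear implicits.

(* Main.v *)
Require Import Defs.
From mathcomp Require Import all_boot all_order all_algebra.
From mathcomp Require Import all_classical all_reals all_analysis.
From HB Require Import structures.
From mathcomp Require Import measurable_realfun ring lra zify.
Import Order.TTheory GRing.Theory Num.Theory.
Import numFieldNormedType.Exports.
Local Open Scope classical_set_scope.
Local Open Scope ring_scope.

(** Write [n_k], [S_k] for the number of pulls of arm [k] and the sum of its
   rewards centred at [mu k], let [i] be a best arm, [j] an arm of gap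
   [D = 3 a > 0].  Everything follows from a bound on the expected number of
   pulls of [j], of order [1 + (1 + ln (max 1 (T D^2))) / D^2]
   ([suboptimal_pulls_le]).

   The likelihood is Gaussian, so up to a factor depending on the data alone it
   is [expR (- \sum_k n_k (v_k - m_k)^2 / (2 sigma^2))] with [m_k] the empirical
   means.  Suppose [j] is not overestimated, [m_j <= mu j + a].  A parameter [v]
   for which [j] is optimal has either [v_j >= mu i - a], and then its likelihood
   is smaller than the maximal one by the factor
   [expR (- n_j a^2 / (2 sigma^2))]; or all its coordinates are below [mu i - a],
   and then raising the single coordinate [v_i] produces a parameter for which
   [i] is optimal, at a controlled change of likelihood.  Taking suprema
   ([posterior_suboptimal_le]), the posterior weight of [j] is at most
   [expR (- n_j a^2 / (2 sigma^2))] plus the weight of [i] times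
   [expR ((S_i^2 / n_i - n_i a^2 / 2) / (2 sigma^2))].  The first term is
   negligible once [n_j] exceeds a multiple of [ln (max 1 (T D^2)) / D^2].  The
   second one charges pulls of [j] to pulls of [i]: since a given value of [n_i]
   is seen by one pull of [i] only, its total is at most the sum over [s] of
   [expR (- s a^2 / (4 sigma^2)) * E (expR (Z_s^2 / (2 sigma^2)))], where
   [Z_s = S_i / sqrt s] at the [s]-th pull is 1-sub-Gaussian.  The expectation is
   finite and bounded uniformly in [s] because [1 < sigma], and the geometric sum
   is of order [1 + 1 / D^2].

   The sub-Gaussian bounds at the random time of the [s]-th pull come from the
   exponential supermartingale [expR (lam S_t - lam^2 n_t / 2)], in the form of
   [live_mart_sum], which pays for all times at once.  The expectation of
   [expR (Z_s^2 / (2 sigma^2))] is computed by slicing [Z_s] into unit bands, so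
   that only probabilities of events occur ([well_estimated_pulls_le],
   [band_sum_le]).  Finally the bound on pulls is summed over the arms, either
   directly ([gap_dependent_term_le]) or after separating the arms of gap at most
   [sqrt (K ln K / T)], which cost at most [T] times that gap
   ([gap_free_term_le]). *)

(** * Sufficient statistics of a dataset *)

Section statistics.
Set Implicit Arguments.
Unset Strict Implicit.
Context {R : realType} {K : nat}.
Implicit Types (D : seq ('I_K * R)) (mu : 'I_K -> R) (j k : 'I_K).

Definition pull_count D k : nat := count (fun a => a.1 == k) D.

Definition deviation mu D k : R := \sum_(a <- D | a.1 == k) (a.2 - mu k).

(** For an arm that was never pulled this is [mu k], since [0 / 0 = 0]. *)
Definition emp_mean mu D k : R := mu k + deviation mu D k / (pull_count D k)%:R.

Definition residual (v : 'I_K -> R) D : R := \sum_(a <- D) (v a.1 - a.2) ^+ 2.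

Lemma pull_count0_deviation mu D k : pull_count D k = 0%N -> deviation mu D k = 0.
Proof.
rewrite /deviation -big_filter /pull_count -size_filter => /size0nil ->.
by rewrite big_nil.
Qed.

Lemma sum_pull_count D k (c : R) :
  \sum_(a <- D | a.1 == k) c = (pull_count D k)%:R * c.
Proof. by rewrite big_const_seq /pull_count iter_addr addr0 mulr_natl. Qed.

Lemma deviation_emp_mean mu D k :
  deviation mu D k = (pull_count D k)%:R * (emp_mean mu D k - mu k).
Proof.
rewrite /emp_mean addrAC subrr add0r mulrCA.
have [n0|n0] := eqVneq (pull_count D k) 0%N.
  by rewrite (pull_count0_deviation mu n0) n0 !mul0r.
by rewrite divff ?mulr1// pnatr_eq0.
Qed.

(** Pythagoras: around the empirical means the cross terms vanish. *)
Lemma residual_emp_mean mu (v : 'I_K -> R) D :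
  residual v D =
    \sum_k (pull_count D k)%:R * (v k - emp_mean mu D k) ^+ 2
    + residual (emp_mean mu D) D.
Proof.
have partition_arm F : \sum_(a <- D) F a = \sum_k \sum_(a <- D | a.1 == k) F a :> R.
  rewrite (exchange_big_dep xpredT)//=; apply: eq_bigr => a _.
  by rewrite (big_pred1 a.1)// => k; rewrite eq_sym.
rewrite /residual !partition_arm -big_split/=; apply: eq_bigr => k _.
set m := emp_mean mu D; set n := (pull_count D k)%:R.
have cross : \sum_(a <- D | a.1 == k) (a.2 - m k) = 0.
  have -> : \sum_(a <- D | a.1 == k) (a.2 - m k)
    = \sum_(a <- D | a.1 == k) ((a.2 - mu k) + (mu k - m k)).
    by apply: eq_bigr => a _; ring.
  rewrite big_split/= sum_pull_count -/(deviation mu D k) deviation_emp_mean -/m.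
  by ring.
have -> : \sum_(a <- D | a.1 == k) (v a.1 - a.2) ^+ 2 =
  \sum_(a <- D | a.1 == k) ((v k - m k) ^+ 2
     + ((m a.1 - a.2) ^+ 2 + (- 2 * (v k - m k)) * (a.2 - m k))).
  by apply: eq_bigr => a /eqP ->; ring.
rewrite big_split/= sum_pull_count; congr (_ + _).
by rewrite big_split/= -mulr_sumr cross mulr0 addr0.
Qed.

End statistics.

(** * Posterior weight of a suboptimal arm *)

Section posterior_bound.
Set Implicit Arguments.
Unset Strict Implicit.
Context {R : realType} {K : nat} (sigma : R) (sigma0 : 0 < sigma).
Implicit Types (D : seq ('I_K * R)) (mu : 'I_K -> R) (i j k : 'I_K).

Let s2 : R := 2 * sigma ^+ 2.
Let s2_gt0 : 0 < s2. Proof. by rewrite mulr_gt0// exprn_gt0. Qed.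

Lemma likelihood_residual (v : 'rV[R]_K) D :
  likelihood sigma v D =
  ((Num.sqrt (2 * pi) * sigma)^-1) ^+ size D * expR (- (residual (v ord0) D / s2)).
Proof.
rewrite /likelihood /residual; elim: D => [|a D ih].
  by rewrite !big_nil mul0r oppr0 expR0 mulr1 expr0.
rewrite !big_cons ih [size _]/= (exprS _ (size D)) mulrACA; congr (_ * _).
by rewrite -expRD -opprD -/s2 -mulrDl.
Qed.

Lemma likelihood_gt0 (v : 'rV[R]_K) D : 0 < likelihood sigma v D.
Proof.
rewrite likelihood_residual mulr_gt0 ?expR_gt0// exprn_gt0// invr_gt0 mulr_gt0//.
by rewrite sqrtr_gt0 mulr_gt0// pi_gt0.
Qed.

Lemma likelihood_le (v v' : 'rV[R]_K) D (e : R) :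
  residual (v' ord0) D + s2 * e <= residual (v ord0) D ->
  likelihood sigma v D <= expR (- e) * likelihood sigma v' D.
Proof.
move=> h; rewrite !likelihood_residual mulrCA ler_wpM2l//.
  by rewrite exprn_ge0// invr_ge0 mulr_ge0 ?sqrtr_ge0// ltW.
by rewrite -expRD ler_expR -opprD lerN2 ler_pdivlMr// mulrDl divfK ?gt_eqF// addrC (mulrC e).
Qed.

Notation profile := (profile_likelihood sigma [set: 'rV[R]_K]).
Notation posterior := (gen_posterior sigma [set: 'rV[R]_K] uniform_prior).

Lemma profile_has_sup j D :
  has_sup [set likelihood sigma v D | v in argmax_set [set: 'rV[R]_K] j].
Proof.
split.
  by exists (likelihood sigma (0 : 'rV[R]_K) D); exists 0 => //; split => // k; rewrite !mxE.
exists (((Num.sqrt (2 * pi) * sigma)^-1) ^+ size D) => _ [v _ <-].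
rewrite likelihood_residual ler_piMr//.
  by rewrite exprn_ge0// invr_ge0 mulr_ge0 ?sqrtr_ge0// ltW.
rewrite -expR0 ler_expR oppr_le0 divr_ge0 ?(ltW s2_gt0)//.
by rewrite /residual sumr_ge0// => a _; rewrite sqr_ge0.
Qed.

Lemma likelihood_le_profile j D (v : 'rV[R]_K) :
  (forall k, v ord0 k <= v ord0 j) -> likelihood sigma v D <= profile j D.
Proof.
by move=> vj; apply: ub_le_sup; [case: (profile_has_sup j D)|exists v].
Qed.

Lemma profile_gt0 j D : 0 < profile j D.
Proof.
apply: (lt_le_trans (likelihood_gt0 (0 : 'rV[R]_K) D)).
by apply: likelihood_le_profile => k; rewrite !mxE.
Qed.

Lemma posteriorE D j : posterior D j = profile j D / \sum_k profile k D.
Proof.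
rewrite /gen_posterior /uniform_prior -mulr_suml invfM invrK.
by rewrite mulrACA mulVf ?mulr1// pnatr_eq0 -lt0n (leq_ltn_trans _ (ltn_ord j)).
Qed.

Let profile_sum_gt0 j D : 0 < \sum_k profile k D.
Proof.
rewrite (bigD1 j)//= ltr_pwDl ?profile_gt0// sumr_ge0// => k _.
exact/ltW/profile_gt0.
Qed.

Lemma posterior_ge0 D j : 0 <= posterior D j.
Proof.
by rewrite posteriorE divr_ge0// ltW// ?profile_gt0//; exact: (profile_sum_gt0 j).
Qed.

Lemma posterior_le1 D j : posterior D j <= 1.
Proof.
rewrite posteriorE ler_pdivrMr ?(profile_sum_gt0 j)// mul1r (bigD1 j)//= lerDl.
by rewrite sumr_ge0// => k _; exact/ltW/profile_gt0.
Qed.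

(** A parameter in the cell of arm [j] either puts [j] at least [a] above its
   empirical mean, and pays for it in likelihood against the empirical means,
   or it has all coordinates below [mu i - a]; then raising coordinate [i]
   alone up to [Num.max (mu i - a) (emp_mean i)] moves it into the cell of
   arm [i] and changes the fit of arm [i] only. *)
Lemma posterior_suboptimal_le mu D i j (a : R) : 0 < a ->
  mu i - mu j = 3 * a ->
  deviation mu D j <= (pull_count D j)%:R * a ->
  posterior D j <=
    expR (- ((pull_count D j)%:R * a ^+ 2 / s2)) +
    expR ((deviation mu D i ^+ 2 / (pull_count D i)%:R
           - (pull_count D i)%:R * a ^+ 2 / 2) / s2) * posterior D i.
Proof.
move=> a0 gapa devj.
set m := emp_mean mu D.
set ej := expR (- _); set gi := expR (_ / _).
pose vm : 'rV[R]_K := \row_k m k.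
have [k0 k0P] : exists k0, forall k, m k <= m k0.
  by have [k0 _ k0P] := @arg_maxP _ R _ j xpredT m isT; exists k0 => k; exact: k0P.
have residE := residual_emp_mean mu.
have term0 (v : 'I_K -> R) k : 0 <= (pull_count D k)%:R * (v k - m k) ^+ 2.
  by rewrite mulr_ge0// sqr_ge0.
suff profj : profile j D <= ej * profile k0 D + gi * profile i D.
  rewrite posteriorE; apply: (@le_trans _ _ (ej * posterior D k0 + gi * posterior D i)).
    rewrite !posteriorE !mulrA -mulrDl ler_wpM2r// invr_ge0 ltW//.
    exact: (profile_sum_gt0 j).
  by rewrite lerD2r ler_piMr ?expR_ge0// posterior_le1.
apply: ge_sup; first by case: (profile_has_sup j D).
move=> _ [v [_ vj] <-].
have [vj_hi|vj_lo] := leP (mu i - a) (v ord0 j).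
  apply: (@le_trans _ _ (ej * profile k0 D)); last first.
    by rewrite lerDl mulr_ge0 ?expR_ge0// ltW// profile_gt0.
  apply: (@le_trans _ _ (ej * likelihood sigma vm D)); last first.
    by rewrite ler_wpM2l ?expR_ge0// likelihood_le_profile// => k; rewrite !mxE.
  apply: likelihood_le.
  have -> : residual (vm ord0) D = residual m D.
    by apply: eq_bigr => b _; rewrite mxE.
  rewrite (residE (v ord0)) -/m addrC lerD2r mulrC divfK ?gt_eqF// (bigD1 j)//=.
  rewrite -[leLHS]addr0 lerD// ?sumr_ge0//.
  have [->|n0] := eqVneq (pull_count D j) 0%N; first by rewrite !mul0r.
  have npos : 0 < (pull_count D j)%:R :> R by rewrite ltr0n lt0n.
  have mja : m j <= mu j + a.
    rewrite -lerBlDl -(ler_pM2l npos).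
    by rewrite -deviation_emp_mean.
  have hv : a <= v ord0 j - m j by lra.
  by rewrite ler_wpM2l// lerXn2r// nnegrE// ltW// (lt_le_trans a0).
apply: (@le_trans _ _ (gi * profile i D)); last first.
  by rewrite lerDr mulr_ge0 ?expR_ge0// ltW// profile_gt0.
pose c := Num.max (mu i - a) (m i).
pose v' : 'rV[R]_K := \row_k (if k == i then c else v ord0 k).
apply: (@le_trans _ _ (gi * likelihood sigma v' D)); last first.
  rewrite ler_wpM2l ?expR_ge0// likelihood_le_profile// => k; rewrite !mxE eqxx.
  case: ifP => // _; rewrite le_max; apply/orP; left.
  by rewrite (le_trans (vj k))// ltW.
rewrite /gi -[X in expR X]opprK; apply: likelihood_le.
rewrite (residE (v ord0)) (residE (v' ord0)) -/m addrAC lerD2r (bigD1 i)//= [leRHS](bigD1 i)//=.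
rewrite addrAC mxE eqxx mulrN (mulrC s2) divfK ?gt_eqF//.
have -> : \sum_(k | k != i) (pull_count D k)%:R * (v' ord0 k - m k) ^+ 2 =
          \sum_(k | k != i) (pull_count D k)%:R * (v ord0 k - m k) ^+ 2.
  by apply: eq_bigr => k /negbTE ki; rewrite mxE ki.
rewrite lerD2r.
have -> : deviation mu D i ^+ 2 / (pull_count D i)%:R =
    (pull_count D i)%:R * (m i - mu i) ^+ 2.
  rewrite deviation_emp_mean -/m; have [->|n0] := eqVneq (pull_count D i) 0%N.
    by rewrite !mul0r expr0n mul0r.
  by field; rewrite pnatr_eq0.
set n := (pull_count D i)%:R.
rewrite -mulrA -mulrBr -mulrBr ler_wpM2l// {}/n.
have vi := vj i.
have vic : v ord0 i < mu i - a by exact: le_lt_trans vj_lo.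
rewrite /c; case: (leP (mu i - a) (m i)) => hm.
  suff : (mu i - a - m i) ^+ 2 <= (v ord0 i - m i) ^+ 2 by have := sqr_ge0 (2 * (m i - mu i) + a); lra.
  rewrite -subr_ge0.
  have -> : (v ord0 i - m i) ^+ 2 - (mu i - a - m i) ^+ 2 =
    (mu i - a - v ord0 i) * (2 * m i - v ord0 i - (mu i - a)) by ring.
  by rewrite mulr_ge0//; lra.
have h : 0 <= a * (mu i - a - m i) by rewrite mulr_ge0 ?(ltW a0)//; lra.
by have := sqr_ge0 (v ord0 i - m i); have := sqr_ge0 a; lra.
Qed.

End posterior_bound.

(** * Inequalities between lower integrals *)

Section lower_integral.
Set Implicit Arguments.
Unset Strict Implicit.
Context d (T : measurableType d) {R : realType}.
Variable mu : {measure set T -> \bar R}.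
Import HBNNSimple.

(** The integral of a nonnegative function is a supremum over simple functions
   below it, which is monotone without any measurability. *)
Lemma le_lower_integral (D : set T) (f g : T -> \bar R) :
  (forall x, D x -> 0 <= f x)%E -> (forall x, D x -> f x <= g x)%E ->
  (\int[mu]_(x in D) f x <= \int[mu]_(x in D) g x)%E.
Proof.
move=> f0 fg; rewrite !ge0_integralE//; last first.
  by move=> x Dx; rewrite (le_trans (f0 x Dx)) ?fg.
apply: le_ereal_sup => _ [h /= hf <-]; exists h => //= x.
rewrite (le_trans (hf x))// /patch; case: ifPn => // xD.
by apply: fg; rewrite inE in xD.
Qed.

(** The posterior weights are built from suprema over uncountable sets, so
   [f] and [g] are arbitrary functions here, for which additivity of the integral
   fails; but a simple function [h <= f] gives the measurable minorant
   [max 0 (h - e) / c] of [g]. *)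
Lemma lower_integral_le_affine (D : set T) (f g : T -> R) (e c : R) :
  measurable D -> 0 <= e -> 0 < c -> (forall x, 0 <= f x) -> (forall x, 0 <= g x) ->
  (forall x, D x -> f x <= e + c * g x) ->
  (\int[mu]_(x in D) (f x)%:E <=
     e%:E * mu D + c%:E * \int[mu]_(x in D) (g x)%:E)%E.
Proof.
move=> mD e0 c0 f0 g0 fg.
rewrite [leLHS]ge0_integralE; last by move=> x _; rewrite lee_fin.
apply: ge_ereal_sup => _ [h /= hf <-]; rewrite -integralT_nnsfun.
pose k x := Num.max 0 (h x - e * \1_D x) / c.
have k0 x : 0 <= k x by rewrite divr_ge0 ?(ltW c0)// le_max lexx.
have mk : measurable_fun setT k.
  apply: measurable_funM => //; apply: measurable_maxr => //.
  by apply: measurable_funB => //; apply: measurable_funM => //; exact: measurable_indic.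
apply: (@le_trans _ _ (\int[mu]_x ((e * \1_D x)%:E + c%:E * (k x)%:E))%E).
  apply: ge0_le_integral => //.
  - by move=> x _; rewrite lee_fin.
  - exact/measurable_EFinP.
  - apply: emeasurable_funD.
      by apply/measurable_EFinP/measurable_funM => //; exact: measurable_indic.
    by apply: emeasurable_funM => //; exact/measurable_EFinP.
  move=> x _; rewrite -EFinM -EFinD lee_fin /k mulrCA divff ?gt_eqF// mulr1.
  by rewrite -lerBlDl le_max lexx orbT.
rewrite ge0_integralD//=; last 4 first.
- by move=> x _; rewrite lee_fin mulr_ge0.
- by apply/measurable_EFinP/measurable_funM => //; exact: measurable_indic.
- by move=> x _; rewrite -EFinM lee_fin mulr_ge0// ltW.
- by apply: emeasurable_funM => //; exact/measurable_EFinP.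
apply: leeD.
  under eq_integral do rewrite EFinM.
  rewrite ge0_integralZl//=; last exact/measurable_EFinP/measurable_indic.
  by rewrite integral_indic// setIT.
rewrite ge0_integralZl//=; [|exact/measurable_EFinP|by move=> x _; rewrite lee_fin|by rewrite lee_fin ltW].
rewrite lee_wpmul2l ?lee_fin ?(ltW c0)//.
rewrite [leRHS]integral_mkcond; apply: le_lower_integral => x _; first by rewrite lee_fin.
have := hf x; rewrite /patch /k indicE; case: ifPn => [xD|_] hx.
  have Dx : D x by rewrite inE in xD.
  have hD : h x - e <= g x * c.
    by rewrite lerBlDl (mulrC _ c) (le_trans _ (fg x Dx)).
  rewrite (_ : true%:R = 1)// mulr1 lee_fin ler_pdivrMr// ge_max hD andbT.
  by rewrite mulr_ge0// ltW.
rewrite -[point]/(0%:E) lee_fin in hx *.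
by rewrite (_ : false%:R = 0)// mulr0 subr0 (max_idPl hx) mul0r.
Qed.

End lower_integral.

(** * Integrating a product of independent functions *)

Section independence.
Set Implicit Arguments.
Unset Strict Implicit.
Local Open Scope ereal_scope.
Context d d1 d2 (Om : measurableType d) (T1 : measurableType d1)
  (T2 : measurableType d2) {R : realType}.
Variables (Q : {finite_measure set Om -> \bar R}) (nu : probability T2 R).
Variables (X : Om -> T1) (Y : Om -> T2).
Hypotheses (mX : measurable_fun setT X) (mY : measurable_fun setT Y).

(** The law of [(X, Y)] agrees with a product measure on rectangles, hence
   everywhere, and Tonelli applies.  [Q] is any finite measure: it will be the
   restriction of a probability to an event. *)
Lemma independent_integral_mul (f : T1 -> \bar R) (g : T2 -> \bar R) :
  (forall A B, measurable A -> measurable B ->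
     Q (X @^-1` A `&` Y @^-1` B) = Q (X @^-1` A) * nu B) ->
  measurable_fun setT f -> (forall x, 0 <= f x) ->
  measurable_fun setT g -> (forall y, 0 <= g y) ->
  \int[Q]_w (f (X w) * g (Y w)) = \int[Q]_w f (X w) * \int[nu]_y g y.
Proof.
move=> ind mf f0 mg g0.
have mXi A : measurable A -> measurable (X @^-1` A).
  by move=> mA; rewrite -[X in measurable X]setTI; exact: mX.
(* [pushforward] is a measure only given measurability of the map; packing it
   once provides the three image measures below. *)
have law_measure d' (T' : measurableType d') (Z : Om -> T')
    (mZ : measurable_fun setT Z) :
    {m : {measure set T' -> \bar R} | m = pushforward Q Z :> (set T' -> \bar R)}.
  by unshelve eexists (pushforward Q Z : {measure set _ -> \bar R}).
have [mu1 mu1E] := law_measure _ _ _ mX.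
have mu1fin : fin_num_fun mu1.
  by move=> A mA; rewrite mu1E; apply: fin_num_measure; exact: mXi.
pose H1 := isFinite.Build _ _ _ _ mu1fin.
have mu1sf : sigma_finite setT mu1 by apply: fin_num_fun_sigma_finite => //; rewrite measure0.
pose H2 := isSFinite.Build _ _ _ _ (sfinite_measure_sigma_finite mu1sf).
pose H3 := isSigmaFinite.Build _ _ _ _ mu1sf.
pose mu1f : {finite_measure set T1 -> \bar R} :=
  HB.pack_for (FiniteMeasure.type T1 R) (Measure.sort mu1) H1 H2 H3.
have mXY : measurable_fun setT (fun w => (X w, Y w)) by exact/measurable_fun_pair.
have [rho rhoE] := law_measure _ _ _ mXY.
have rho_prod : forall C, measurable C -> (mu1f \x nu) C = rho C.
  apply: product_measure_unique => A B mA mB.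
  by rewrite rhoE /= mu1E /pushforward -ind.
have int1 (h : T1 -> \bar R) : measurable_fun setT h -> (forall x, 0 <= h x) ->
    \int[mu1]_x h x = \int[Q]_w h (X w).
  move=> mh h0; rewrite (eq_measure_integral (pushforward Q X : {measure set _ -> \bar R})).
    by rewrite ge0_integral_pushforward.
  by move=> A _ _; rewrite mu1E.
transitivity (\int[rho]_z (f z.1 * g z.2)).
  rewrite (eq_measure_integral (pushforward Q (fun w => (X w, Y w)) : {measure set _ -> \bar R})).
    rewrite ge0_integral_pushforward//.
      apply: emeasurable_funM; exact: measurableT_comp.
    by move=> z _; rewrite mule_ge0.
  by move=> A _ _; rewrite rhoE.
rewrite (eq_measure_integral (mu1f \x nu)); last by move=> C mC _; rewrite -rho_prod.
rewrite fubini_tonelli1; last 2 first.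
- by apply: emeasurable_funM; exact: measurableT_comp.
- by move=> z; rewrite mule_ge0.
rewrite /fubini_F /=; under eq_integral do rewrite ge0_integralZl//.
rewrite ge0_integralZr//; last exact: integral_ge0.
by rewrite int1.
Qed.
End independence.

(** * Measurability along a run *)

Section statistics_of_run.
Set Implicit Arguments.
Unset Strict Implicit.
Context {R : realType} {K : nat} (mu : 'I_K -> R).

Section recursion.
Context {Om : Type} (x : nat -> Om -> 'I_K) (phi : nat -> Om -> R).
Implicit Types (t : nat) (w : Om).

Lemma datasetS t w :
  dataset x phi t.+1 w = rcons (dataset x phi t w) (x t.+1 w, phi t.+1 w).
Proof. by rewrite /dataset -[in iota _ _](addn1 t) iotaD map_cat cats1. Qed.

Lemma pull_count_datasetS j t w :
  pull_count (dataset x phi t.+1 w) j =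
  (pull_count (dataset x phi t w) j + (x t.+1 w == j))%N.
Proof. by rewrite datasetS -cats1 /pull_count count_cat /= addn0. Qed.

Lemma deviation_datasetS j t w :
  deviation mu (dataset x phi t.+1 w) j =
  deviation mu (dataset x phi t w) j +
    (if x t.+1 w == j then phi t.+1 w - mu j else 0).
Proof. by rewrite datasetS /deviation -cats1 big_cat big_mkcond/= [X in _ + X]big_mkcond big_seq1 -big_mkcond. Qed.

Lemma pull_count_dataset_le j t w : (pull_count (dataset x phi t w) j <= t)%N.
Proof. by rewrite (leq_trans (count_size _ _))// size_map size_iota. Qed.

End recursion.

Context d (Om : measurableType d) (x : nat -> Om -> 'I_K) (phi : nat -> Om -> R).

(** Stated for an arbitrary sigma-algebra on [Om], because it is used for the
   ambient one and for those generated by the data. *)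
Definition data_measurable t := forall i, (1 <= i <= t)%N ->
  (forall j, measurable (x i @^-1` [set j])) /\
  measurable_fun setT (phi i : Om -> measurableTypeR R).

Lemma measurable_eq_arm i j : measurable (x i @^-1` [set j]) ->
  measurable_fun setT (fun w => x i w == j).
Proof.
move=> mx; apply: (measurable_fun_bool true); rewrite setTI.
by rewrite (_ : _ @^-1` _ = x i @^-1` [set j])//; apply/seteqP; split=> w /eqP.
Qed.

Lemma measurable_pull_count j t : data_measurable t ->
  measurable_fun setT (fun w => pull_count (dataset x phi t w) j).
Proof.
elim: t => [_|t ih mt]; first exact: measurable_cst.
under eq_fun do rewrite pull_count_datasetS.
apply: measurable_fun_addn.
  by apply: ih => i /andP[i1 it]; apply: mt; rewrite i1 leqW.
apply: (measurable_fun_ifT (f := fun w => x t.+1 w == j) (g := cst 1%N) (h := cst 0%N)) => //.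
by apply: measurable_eq_arm; apply: (mt t.+1 _).1; rewrite leqnn.
Qed.

Lemma measurable_deviation j t : data_measurable t ->
  measurable_fun setT (fun w => deviation mu (dataset x phi t w) j).
Proof.
elim: t => [_|t ih mt].
  by under eq_fun do rewrite /deviation big_nil; exact: measurable_cst.
under eq_fun do rewrite deviation_datasetS.
apply: measurable_funD.
  by apply: ih => i /andP[i1 it]; apply: mt; rewrite i1 leqW.
have [mx mp] : (forall j, measurable (x t.+1 @^-1` [set j])) /\
    measurable_fun setT (phi t.+1 : Om -> measurableTypeR R).
  by apply: mt; rewrite leqnn.
apply: measurable_fun_ifT => //; first exact: measurable_eq_arm.
exact: measurable_funB.
Qed.

End statistics_of_run.

Section filtration.
Set Implicit Arguments.
Unset Strict Implicit.
Context {R : realType} {K : nat} d (Om : measurableType d)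
  (x : nat -> Om -> 'I_K) (phi : nat -> Om -> R).

Definition data_generators t : set (set Om) :=
  [set A | exists i, (1 <= i <= t)%N /\
        ((exists j : 'I_K, A = x i @^-1` [set j]) \/
         (exists2 B : set (measurableTypeR R),
            measurable B & A = phi i @^-1` B))].

Definition arm_generators t : set (set Om) :=
  sigma_data x phi t `|` [set A | exists j : 'I_K, A = x t.+1 @^-1` [set j]].

(** [Om] with the sigma-algebra of the first [t] rounds, respectively of these
   rounds and the next arm, so that measurability with respect to the past is
   ordinary [measurable_fun]. *)
Definition data_space t := g_sigma_algebraType (data_generators t).
Definition data_arm_space t := g_sigma_algebraType (arm_generators t).

Lemma data_measurable_sub (G : set (set Om)) t : data_generators t `<=` <<s G >> ->
  @data_measurable R K _ (g_sigma_algebraType G) x phi t.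
Proof.
move=> sub i it; split=> [j|_ B mB].
  by apply: sub; exists i; split => //; left; exists j.
by rewrite setTI; apply: sub; exists i; split => //; right; exists B.
Qed.

Lemma data_space_measurable t : @data_measurable R K _ (data_space t) x phi t.
Proof. by apply: data_measurable_sub; exact: sub_sigma_algebra. Qed.

Lemma data_arm_space_measurable t :
  @data_measurable R K _ (data_arm_space t) x phi t.
Proof.
apply: data_measurable_sub => A AG; apply: sub_sigma_algebra; left.
exact: sub_sigma_algebra.
Qed.

Lemma measurable_arm_data_arm_space t j :
  measurable (x t.+1 @^-1` [set j] : set (data_arm_space t)).
Proof. by apply: sub_sigma_algebra; right; exists j. Qed.

Hypothesis mx : forall t j, measurable (x t.+1 @^-1` [set j]).
Hypothesis mphi : forall t, measurable_fun setT (phi t.+1 : Om -> measurableTypeR R).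

Lemma data_measurable_full t : data_measurable x phi t.
Proof. by move=> [|i]// _; split => //. Qed.

Lemma sigma_data_measurable t A : sigma_data x phi t A -> measurable A.
Proof.
apply: smallest_sub; first exact: sigma_algebra_measurable.
move=> B [[|i] [// _]] [[j ->]//|[C mC ->]].
by rewrite -[X in measurable X]setTI; exact: mphi.
Qed.

Lemma sigma_data_arm_measurable t A : sigma_data_arm x phi t A -> measurable A.
Proof.
apply: smallest_sub; first exact: sigma_algebra_measurable.
by move=> B [/sigma_data_measurable//|[j ->]].
Qed.

End filtration.

(** * An exponential supermartingale *)

Section restricted_measure.
Set Implicit Arguments.
Unset Strict Implicit.
Context d (T : measurableType d) {R : realType}.

Lemma integral_mrestr_support (m : {measure set T -> \bar R}) (D : set T)
    (mD : measurable D) (f : T -> \bar R) : (forall w, ~ D w -> f w = 0%E) ->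
  (\int[mrestr m mD]_w f w = \int[m]_w f w)%E.
Proof.
move=> f0; have fD : f = f \_ D.
  by apply/funext => w; rewrite /patch; case: ifPn => // /negP; rewrite inE => /f0.
rewrite fD -!(integral_mkcond D); apply: eq_measure_integral => A mA AD.
by rewrite /= /mrestr setIidl.
Qed.

End restricted_measure.

Section exponential_supermartingale.
Set Implicit Arguments.
Unset Strict Implicit.
Context {R : realType} {K : nat} (sigma : R) (Theta : set 'rV[R]_K)
  (Q0 : 'I_K -> R) (nu : 'I_K -> real_law R) (mu : 'I_K -> R)
  d (Om : measurableType d) (P : probability Om R)
  (x : nat -> Om -> 'I_K) (phi : nat -> Om -> R).
Hypothesis subg : forall j, one_subgaussian (nu j) (mu j).
Hypothesis run : mints_run sigma Theta Q0 nu P x phi.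
Variables (j : 'I_K) (lam : R) (s : nat).

Let mx := mints_measurable_arm run.
Let mphi := mints_measurable_feedback run.
Notation N t w := (pull_count (dataset x phi t w) j).
Notation S t w := (deviation mu (dataset x phi t w) j).

Definition exp_mart t w : R := expR (lam * S t w - lam ^+ 2 / 2 * (N t w)%:R).

(** [live_mart] follows the martingale until the pull number [s + 1] of arm [j];
   [stopping_mart] is its value at that pull. *)
Definition live_mart t w : R := (N t w <= s)%:R * exp_mart t w.

Definition stopping_mart t w : R :=
  ((x t.+1 w == j) && (N t w == s))%:R * exp_mart t w.

Let exp_mart_ge0 t w : 0 <= exp_mart t w. Proof. exact: expR_ge0. Qed.

(** Given that arm [j] is pulled, the next reward has law [nu j] and is
   independent of the past: restricted to that event, [P] makes the past and
   the reward independent. *)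
Lemma feedback_product t (f : data_arm_space x phi t -> \bar R)
    (g : measurableTypeR R -> \bar R) :
  measurable_fun setT f -> (forall w, 0 <= f w)%E ->
  measurable_fun setT g -> (forall r, 0 <= g r)%E ->
  (forall w, x t.+1 w != j -> f w = 0%E) ->
  (\int[P]_w (f w * g (phi t.+1 w)) = \int[P]_w f w * \int[nu j]_r g r)%E.
Proof.
move=> mf f0 mg g0 fj.
have fj0 w : ~ (x t.+1 @^-1` [set j]) w -> f w = 0%E.
  by move=> xj; apply: fj; apply/negP => /eqP.
rewrite -(integral_mrestr_support P (mx t j)); last by move=> w /fj0 ->; rewrite mul0e.
rewrite -[in RHS](integral_mrestr_support P (mx t j))//.
apply: (@independent_integral_mul _ _ _ Om (data_arm_space x phi t)) => //.
  move=> _ B mB; rewrite setTI preimage_id; exact: (sigma_data_arm_measurable mx mphi mB).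
move=> A B mA mB; rewrite /= /mrestr preimage_id.
have mAj : measurable (A `&` x t.+1 @^-1` [set j] : set (data_arm_space x phi t)).
  by apply: measurableI => //; exact: measurable_arm_data_arm_space.
rewrite setIAC (mints_feedback_law run)//.
rewrite (eq_integral (cst (nu j B))); last by move=> w /[1!inE] -[_ ->].
by rewrite integral_cst 1?muleC//; exact: (sigma_data_arm_measurable mx mphi mAj).
Qed.

Lemma measurable_exp_mart d' (Om' : measurableType d') (x' : nat -> Om' -> 'I_K)
    (phi' : nat -> Om' -> R) t : data_measurable x' phi' t ->
  measurable_fun setT (fun w => expR (lam * deviation mu (dataset x' phi' t w) j
    - lam ^+ 2 / 2 * (pull_count (dataset x' phi' t w) j)%:R)).
Proof.
move=> h; apply: measurableT_comp => //; apply: measurable_funB.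
  by apply: measurable_funM => //; exact: measurable_deviation.
apply: measurable_funM => //.
have mnat : measurable_fun setT (fun n : nat => n%:R : R) by [].
exact: (measurableT_comp mnat (measurable_pull_count _ h)).
Qed.

Lemma measurable_natb d' (Om' : measurableType d') (b : Om' -> bool) :
  measurable_fun setT b -> measurable_fun setT (fun w => (b w)%:R : R).
Proof.
move=> mb; rewrite (_ : (fun _ => _) = fun w => if b w then 1 else 0).
  exact: measurable_fun_ifT.
by apply/funext => w; case: (b w).
Qed.


Let factor (r : R) : \bar R := (expR (lam * (r - mu j) - lam ^+ 2 / 2))%:E.

Let mfactor : measurable_fun setT (factor : measurableTypeR R -> \bar R).
Proof.
apply/measurable_EFinP/measurableT_comp => //.
by apply: measurable_funB => //; apply: measurable_funM => //; exact: measurable_funB.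
Qed.

Let integral_factor_le1 : (\int[nu j]_r factor r <= 1)%E.
Proof.
rewrite /factor; under eq_integral do rewrite expRD mulrC EFinM.
rewrite ge0_integralZl//.
- apply: (@le_trans _ _ ((expR (- (lam ^+ 2 / 2)))%:E * (expR (lam ^+ 2 / 2))%:E)%E).
    by rewrite lee_wpmul2l//; have := subg j lam; rewrite unlock.
  by rewrite -EFinM -expRD addNr expR0.
- apply/measurable_EFinP/measurableT_comp => //.
  by apply: measurable_funM => //; exact: measurable_funB.
Qed.

Let other_mart t w : R := ((x t.+1 w != j) && (N t w <= s)%N)%:R * exp_mart t w.
Let running_mart t w : R := ((x t.+1 w == j) && (N t w < s)%N)%:R * exp_mart t w.

Let measurable_indic_mart d' (Om' : measurableType d') (x' : nat -> Om' -> 'I_K)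
    (phi' : nat -> Om' -> R) t (b : Om' -> bool) :
  data_measurable x' phi' t -> measurable_fun setT b ->
  measurable_fun setT (fun w => (b w)%:R * expR (lam * deviation mu (dataset x' phi' t w) j
    - lam ^+ 2 / 2 * (pull_count (dataset x' phi' t w) j)%:R)).
Proof.
by move=> mt mb; apply: measurable_funM; [exact: measurable_natb|exact: measurable_exp_mart].
Qed.

Let full t : data_measurable x phi t := data_measurable_full mx mphi (t := t).

Let mlive t : measurable_fun setT (EFin \o live_mart t).
Proof.
apply/measurable_EFinP/measurable_indic_mart => //.
by apply: measurable_fun_leq => //; exact: measurable_pull_count.
Qed.

Let mother t : measurable_fun setT (EFin \o other_mart t).
Proof.
apply/measurable_EFinP/measurable_indic_mart => //; apply: measurable_and.
  by apply: measurable_neg; exact: measurable_eq_arm.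
by apply: measurable_fun_leq => //; exact: measurable_pull_count.
Qed.

Let mstopping t : measurable_fun setT (EFin \o stopping_mart t).
Proof.
apply/measurable_EFinP/measurable_indic_mart => //; apply: measurable_and.
  exact: measurable_eq_arm.
by apply: measurable_fun_eqn => //; exact: measurable_pull_count.
Qed.

Let mrunning t : measurable_fun setT
  (EFin \o running_mart t : data_arm_space x phi t -> \bar R).
Proof.
have mt : @data_measurable R K _ (data_arm_space x phi t) x phi t.
  exact: data_arm_space_measurable.
apply/measurable_EFinP/measurable_indic_mart => //; apply: measurable_and.
  apply: (measurable_eq_arm (Om := data_arm_space x phi t)).
  exact: measurable_arm_data_arm_space.
by apply: measurable_fun_ltn => //; exact: measurable_pull_count.
Qed.

Let mrunning_full t : measurable_fun setT (EFin \o running_mart t).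
Proof.
apply/measurable_EFinP/measurable_indic_mart => //; apply: measurable_and.
  exact: measurable_eq_arm.
by apply: measurable_fun_ltn => //; exact: measurable_pull_count.
Qed.

Let mprod t : measurable_fun setT (fun w => (running_mart t w)%:E * factor (phi t.+1 w))%E.
Proof.
apply: emeasurable_funM; first exact: mrunning_full.
exact: (measurableT_comp mfactor (mphi t)).
Qed.

Let mart_ge0 (b : bool) t w : (0 <= (b%:R * exp_mart t w)%:E)%E.
Proof. by rewrite lee_fin mulr_ge0. Qed.

(** Three cases: another arm is pulled and nothing changes; arm [j] is pulled
   for the [s + 1]-st time and the mass moves to [stopping_mart]; or it is pulled
   earlier and the mass is multiplied by a factor of conditional mean at
   most [1]. *)
Lemma live_mart_step t :
  (\int[P]_w (live_mart t.+1 w)%:E + \int[P]_w (stopping_mart t w)%:E <=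
   \int[P]_w (live_mart t w)%:E)%E.
Proof.
have prod_ge0 w : (0 <= (running_mart t w)%:E * factor (phi t.+1 w))%E.
  by rewrite mule_ge0 ?mart_ge0// lee_fin expR_ge0.
have -> : (\int[P]_w (live_mart t.+1 w)%:E = \int[P]_w (other_mart t w)%:E +
    \int[P]_w ((running_mart t w)%:E * factor (phi t.+1 w)))%E.
  rewrite -ge0_integralD//; [|by move=> w _; exact: mart_ge0|exact: mother].
  apply: eq_integral => w _; rewrite -EFinM -EFinD; congr EFin.
  rewrite /live_mart /other_mart /running_mart /exp_mart pull_count_datasetS deviation_datasetS.
  case: eqVneq => xj /=; last by rewrite addn0 addr0 mul0r mul0r addr0.
  rewrite addn1 mul0r add0r -[RHS]mulrA -expRD; congr (_ * expR _).
  by rewrite -natr1; ring.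
have -> : (\int[P]_w ((running_mart t w)%:E * factor (phi t.+1 w)) =
    \int[P]_w (running_mart t w)%:E * \int[nu j]_r factor r)%E.
  apply: (feedback_product (@mrunning t)) => //.
  - by move=> w; exact: mart_ge0.
  - by move=> r; rewrite lee_fin expR_ge0.
  by move=> w /negbTE xj; rewrite /= /running_mart xj mul0r.
have run0 : (0 <= \int[P]_w (running_mart t w)%:E)%E.
  by apply: integral_ge0 => w _; exact: mart_ge0.
apply: (@le_trans _ _ (\int[P]_w (other_mart t w)%:E + \int[P]_w (running_mart t w)%:E
   + \int[P]_w (stopping_mart t w)%:E)%E).
  by rewrite leeD// leeD// -[leRHS]mule1 lee_wpmul2l.
rewrite -ge0_integralD//; [|by move=> w _; exact: mart_ge0|exact: mother|by move=> w _; exact: mart_ge0|exact: mrunning_full].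
have other_running_ge0 w : (0 <= (other_mart t w)%:E + (running_mart t w)%:E)%E.
  by rewrite adde_ge0 ?mart_ge0.
have mother_running : measurable_fun setT
    (fun w => (other_mart t w)%:E + (running_mart t w)%:E)%E.
  by apply: emeasurable_funD; [exact: mother|exact: mrunning_full].
rewrite -ge0_integralD//; [|by move=> w _; exact: mart_ge0|exact: mstopping].
apply: ge0_le_integral => //.
- by move=> w _; rewrite adde_ge0 ?mart_ge0.
- by apply: emeasurable_funD => //; exact: mstopping.
- exact: mlive.
move=> w _; rewrite -!EFinD lee_fin /live_mart /other_mart /running_mart /stopping_mart.
rewrite -!mulrDl ler_wpM2r// -!natrD ler_nat.
case: (x t.+1 w == j) => /=; case: (ltngtP (N t w) s) => /= _; rewrite ?addn0 ?add0n //.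
Qed.

(** The initial mass [1] pays for the stopping values of all rounds together;
   this is what replaces stopping times below. *)
Lemma live_mart_sum t :
  (\int[P]_w (live_mart t w)%:E + \sum_(i < t) \int[P]_w (stopping_mart i w)%:E <= 1)%E.
Proof.
elim: t => [|t ih].
  rewrite big_ord0 adde0 -(@probability_setT _ _ _ P) -[leRHS]mul1e.
  rewrite -integral_cst//; apply: ge0_le_integral => //.
  - by move=> w _; exact: mart_ge0.
  - exact: mlive.
  move=> w _; rewrite lee_fin /live_mart /exp_mart /pull_count /deviation /= big_nil.
  by rewrite !mulr0 subr0 expR0 mulr1.
rewrite big_ord_recr/= addeA addeAC (le_trans _ ih)//.
by rewrite leeD2r// live_mart_step.
Qed.

Let tail_le (A : set Om) (b : R) t (f : Om -> R) :
  measurable A -> measurable_fun setT (EFin \o f) ->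
  (forall w, 0 <= f w) ->
  (forall w, A w -> b <= lam * S t w /\ f w = exp_mart t w /\ N t w = s) ->
  (P A <= (expR (lam ^+ 2 / 2 * s%:R - b))%:E * \int[P]_w (f w)%:E)%E.
Proof.
move=> mA mf f0 Af; rewrite -ge0_integralZl//; last by move=> w _; rewrite lee_fin.
rewrite -[A]setIT -integral_indic//; apply: ge0_le_integral => //.
- by apply/measurable_EFinP; exact: measurable_indic.
- exact: measurable_funeM.
move=> w _; rewrite -EFinM lee_fin indicE; have [|_] := boolP (w \in A); last first.
  by rewrite mulr_ge0 ?expR_ge0.
rewrite inE => /Af[bS [-> Ns]]; rewrite /exp_mart Ns -expRD -expR0 ler_expR.
lra.
Qed.

(** Chernoff at a fixed time. *)
Lemma time_tail (A : set Om) (b : R) t : measurable A ->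
  (forall w, A w -> N t w = s /\ b <= lam * S t w) ->
  (P A <= (expR (lam ^+ 2 / 2 * s%:R - b))%:E)%E.
Proof.
move=> mA AE; apply: (le_trans (tail_le (b := b) (t := t) mA (mlive t) _ _)).
- by move=> w; rewrite -lee_fin; exact: mart_ge0.
- by move=> w /AE[Ns ?]; split=> //; split=> //; rewrite /live_mart Ns leqnn mul1r.
rewrite -[leRHS]mule1 lee_wpmul2l ?lee_fin ?expR_ge0//.
apply: le_trans (live_mart_sum t); rewrite leeDl// sume_ge0// => i _.
by apply: integral_ge0 => w _; exact: mart_ge0.
Qed.

(** Chernoff at the random round of the [s + 1]-st pull of [j]: one bound for the
   sum over all rounds, since that pull happens at most once. *)
Lemma pulls_tail (A : nat -> set Om) (b : R) T : (forall t, measurable (A t)) ->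
  (forall t w, A t w -> [/\ x t.+1 w = j, N t w = s & b <= lam * S t w]) ->
  (\sum_(t < T) P (A t) <= (expR (lam ^+ 2 / 2 * s%:R - b))%:E)%E.
Proof.
move=> mA AE.
apply: (@le_trans _ _ ((expR (lam ^+ 2 / 2 * s%:R - b))%:E *
    \sum_(t < T) \int[P]_w (stopping_mart t w)%:E)%E).
  rewrite ge0_sume_distrr; last by move=> t _; apply: integral_ge0 => w _; exact: mart_ge0.
  apply: lee_sum => t _; apply: (tail_le (t := t) (mA t) (mstopping t)).
  - by move=> w; rewrite -lee_fin; exact: mart_ge0.
  - by move=> w /AE[xj Ns ?]; split=> //; split=> //; rewrite /stopping_mart xj Ns !eqxx mul1r.
rewrite -[leRHS]mule1 lee_wpmul2l ?lee_fin ?expR_ge0//.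
apply: le_trans (live_mart_sum T); rewrite leeDr//.
by apply: integral_ge0 => w _; exact: mart_ge0.
Qed.

End exponential_supermartingale.

(** * Finite partitions of events *)

Section finite_probability.
Set Implicit Arguments.
Unset Strict Implicit.
Context {R : realType} d (Om : measurableType d) (P : probability Om R).

Definition pr (A : set Om) : R := fine (P A).

Lemma prE A : measurable A -> P A = (pr A)%:E.
Proof. by move=> mA; rewrite fineK// fin_num_measure. Qed.

Lemma pr_set0 : pr set0 = 0.
Proof. by rewrite /pr measure0. Qed.

Lemma pr_ge0 A : 0 <= pr A.
Proof. exact: fine_ge0. Qed.

Lemma pr_le A B : measurable A -> measurable B -> A `<=` B -> pr A <= pr B.
Proof. by move=> mA mB AB; rewrite -lee_fin -!prE// le_measure ?inE. Qed.

Lemma pr_le1 A : measurable A -> pr A <= 1.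
Proof. by move=> mA; rewrite -lee_fin -prE// probability_le1. Qed.

Lemma pr_setU_le A B : measurable A -> measurable B -> pr (A `|` B) <= pr A + pr B.
Proof.
by move=> mA mB; rewrite -lee_fin EFinD -!prE//; [exact: measureU2|exact: measurableU].
Qed.

Lemma pr_le_setU A B C : measurable A -> measurable B -> measurable C ->
  A `<=` B `|` C -> pr A <= pr B + pr C.
Proof.
move=> mA mB mC ABC; apply: le_trans (pr_setU_le mB mC).
by apply: pr_le => //; exact: measurableU.
Qed.

Lemma total_probability (I : finType) (f : Om -> I) (A : set Om) :
  measurable A -> (forall i, measurable (f @^-1` [set i])) ->
  pr A = \sum_i pr (A `&` f @^-1` [set i]).
Proof.
move=> mA mf; have mAf i : measurable (A `&` f @^-1` [set i]) by exact: measurableI.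
apply: EFin_inj; rewrite -prE// -sumEFin -[in LHS](setIT A) -integral_indic//.
under [RHS]eq_bigr => i _ do rewrite -prE// -[X in P X]setIT -integral_indic//.
rewrite -ge0_integral_sum//; last first.
  by move=> i; apply/measurable_EFinP; exact: measurable_indic.
apply: eq_integral => w _; rewrite sumEFin; congr EFin.
rewrite (bigD1 (f w))//= big1 ?addr0 => [|i /eqP ifw].
  by rewrite !indicE in_setI (mem_set (A := _ @^-1` _))// andbT.
by rewrite indicE memNset// => -[_ /= fi]; exact: ifw.
Qed.

End finite_probability.

Section truncn_measurable.
Context {R : realType}.

Lemma measurable_truncn : measurable_fun setT (@Num.truncn R).
Proof.
have m1 n : measurable (@Num.truncn R @^-1` [set n]).
  have mgt m : measurable [set r : R | (m < Num.truncn r)%N].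
    rewrite (_ : [set _ | _] = `[m.+1%:R, +oo[%classic)//.
    by apply/seteqP; split=> r /=; rewrite truncn_gt_nat in_itv/= andbT.
  case: n => [|n].
    rewrite (_ : _ @^-1` _ = ~` [set r : R | (0 < Num.truncn r)%N]); first exact: measurableC.
    by apply/seteqP; split=> r /=; rewrite lt0n; [move=> ->|move=> /negP; rewrite negbK => /eqP].
  rewrite (_ : _ @^-1` _ = [set r : R | (n < Num.truncn r)%N] `\`
      [set r : R | (n.+1 < Num.truncn r)%N]); first exact: measurableD.
  apply/seteqP; split=> r /=; first by move=> ->; rewrite !ltnn; split.
  by move=> [h1 /negP]; rewrite -leqNgt => h2; apply/eqP; rewrite eqn_leq h2.
move=> _ B _; rewrite setTI.
rewrite (_ : _ @^-1` B = \bigcup_(n in B) (@Num.truncn R @^-1` [set n])).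
  exact: bigcup_measurable.
apply/seteqP; split=> [r Br|r [n Bn /= rn]]; first by exists (Num.truncn r).
by rewrite /preimage/= rn.
Qed.

End truncn_measurable.

(** * Expected pulls of a suboptimal arm *)

Section pull_bound.
Set Implicit Arguments.
Unset Strict Implicit.
Context {R : realType} {K : nat} (sigma : R) (sigma0 : 0 < sigma)
  (nu : 'I_K -> real_law R) (mu : 'I_K -> R)
  d (Om : measurableType d) (P : probability Om R)
  (x : nat -> Om -> 'I_K) (phi : nat -> Om -> R).
Hypothesis subg : forall j, one_subgaussian (nu j) (mu j).
Hypothesis run : mints_run sigma [set: 'rV[R]_K] uniform_prior nu P x phi.
Implicit Types (i j : 'I_K) (t s k : nat) (w : Om).

Let mx := mints_measurable_arm run.
Let mphi := mints_measurable_feedback run.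
Let s2 : R := 2 * sigma ^+ 2.
Let s2_gt0 : 0 < s2. Proof. by rewrite mulr_gt0// exprn_gt0. Qed.
Notation N j t w := (pull_count (dataset x phi t w) j).
Notation S j t w := (deviation mu (dataset x phi t w) j).
Notation posterior t w j :=
  (gen_posterior sigma [set: 'rV[R]_K] uniform_prior (dataset x phi t w) j).
Notation pr := (pr P).
Notation mpast := (sigma_data_measurable mx mphi).

Definition pulled j t : set Om := x t.+1 @^-1` [set j].

(** Domination of posterior weights on an event of the past passes to the
   probabilities of the next pull. *)
Lemma arm_domination t (A : set Om) i j (e c : R) : sigma_data x phi t A ->
  0 <= e -> 0 < c ->
  (forall w, A w -> posterior t w j <= e + c * posterior t w i) ->
  pr (A `&` pulled j t) <= e * pr A + c * pr (A `&` pulled i t).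
Proof.
move=> pA e0 c0 Aji; have mA := mpast pA.
rewrite -lee_fin EFinD !EFinM -!prE//; try by apply: measurableI => //; exact: mx.
rewrite !(mints_arm_law run)//; apply: lower_integral_le_affine => // w; exact: posterior_ge0.
Qed.

(** Before the first pull this is [0 / 0 = 0]. *)
Definition zscore j t w : R := `|S j t w| / Num.sqrt (N j t w)%:R.

Let nat_real_measurable d' (Om' : measurableType d') (f : Om' -> nat) (g : nat -> R) :
  measurable_fun setT f -> measurable_fun setT (fun v => g (f v)).
Proof. by move=> mf; apply: (measurableT_comp (f := g)) => // _ B _. Qed.

Let mN j t : measurable_fun setT (fun w : data_space x phi t => N j t w).
Proof. exact/measurable_pull_count/data_space_measurable. Qed.

Let mS j t : measurable_fun setT (fun w : data_space x phi t => S j t w).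
Proof. exact/measurable_deviation/data_space_measurable. Qed.

Let mz j t : measurable_fun setT (fun w : data_space x phi t => zscore j t w).
Proof.
apply: measurable_funM; first exact: measurableT_comp.
exact: (nat_real_measurable (fun n => (Num.sqrt n%:R)^-1)).
Qed.

Let past_bool t (b : Om -> bool) :
  measurable_fun setT (b : data_space x phi t -> bool) ->
  sigma_data x phi t [set w | b w].
Proof.
move=> /(_ measurableT [set true]); rewrite setTI => /(_ I).
by rewrite (_ : _ @^-1` _ = [set w | b w])//; apply/seteqP; split=> w /=.
Qed.

Lemma past_count_eq j t s : sigma_data x phi t [set w | N j t w == s].
Proof. by apply: past_bool; exact: measurable_fun_eqn. Qed.

Lemma past_sample_dev j t (b : nat -> R) : sigma_data x phi t [set w | S j t w <= b (N j t w)].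
Proof. by apply: past_bool; apply: measurable_fun_ler => //; exact: nat_real_measurable. Qed.

Lemma past_count_ge j t l : sigma_data x phi t [set w | (l <= N j t w)%N].
Proof. by apply: past_bool; exact: measurable_fun_leq. Qed.

Lemma past_dev_ge0 j t : sigma_data x phi t [set w | 0 <= S j t w].
Proof. by apply: past_bool; exact: measurable_fun_ler. Qed.

Section cells.
Variables (i : 'I_K) (T' kmax : nat).

(** The standardized deviation is rounded down and capped at [kmax] to leave
   finitely many cells. *)
Definition cell t w : 'I_T'.+1 * 'I_kmax.+1 :=
  (inord (N i t w), inord (minn (Num.truncn (zscore i t w)) kmax)).

Lemma past_cell t sk : sigma_data x phi t (cell t @^-1` [set sk]).
Proof.
have mN' : measurable_fun setT (fun w : data_space x phi t => inord (N i t w) == sk.1 :> 'I_T'.+1).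
  exact: (measurableT_comp (f := fun n => inord n == sk.1)).
have mz' : measurable_fun setT (fun w : data_space x phi t =>
    inord (minn (Num.truncn (zscore i t w)) kmax) == sk.2 :> 'I_kmax.+1).
  apply: (measurableT_comp (f := fun n => inord (minn n kmax) == sk.2)) => //.
  exact: (measurableT_comp measurable_truncn).
rewrite (_ : _ @^-1` _ = [set w | (inord (N i t w) == sk.1 :> 'I_T'.+1) &&
    (inord (minn (Num.truncn (zscore i t w)) kmax) == sk.2 :> 'I_kmax.+1)]).
  by apply: past_bool; exact: measurable_and.
by case: sk {mN' mz'} => s k; apply/seteqP; split=> w /=;
  [move=> [<- <-]; rewrite !eqxx|move=> /andP[/eqP <- /eqP <-]].
Qed.

Lemma cell_count t w sk : (t <= T')%N -> cell t w = sk -> N i t w = sk.1.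
Proof.
by move=> tT <-; rewrite /= inordK// ltnS (leq_trans (pull_count_dataset_le _ _ _ _ _)).
Qed.

Let z_ge0 t w : 0 <= zscore i t w.
Proof. by rewrite divr_ge0// sqrtr_ge0. Qed.

Lemma cell_band_ge t w sk : cell t w = sk -> sk.2%:R <= zscore i t w.
Proof.
move=> <-; rewrite /= inordK ?ltnS ?geq_minr//.
rewrite (@le_trans _ _ (Num.truncn (zscore i t w))%:R) ?ler_nat ?geq_minl//.
by rewrite truncn_le.
Qed.

Lemma cell_band_lt t w sk : cell t w = sk -> (sk.2 < kmax)%N ->
  zscore i t w < sk.2.+1%:R.
Proof.
move=> <-; rewrite /= inordK ?ltnS ?geq_minr// => h.
by have := truncnS_gt (zscore i t w); congr (_ < _%:R); move: h; rewrite /minn; case: ifP => // _; rewrite ltnn.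
Qed.

End cells.


Let zscore_sqr j t w : zscore j t w ^+ 2 = S j t w ^+ 2 / (N j t w)%:R.
Proof. by rewrite /zscore expr_div_n -normrX ger0_norm ?sqr_ge0// sqr_sqrtr. Qed.

Let lam_sqr (b : R) s : (b / Num.sqrt s%:R) ^+ 2 / 2 * s%:R - b ^+ 2 <= - (b ^+ 2 / 2).
Proof.
have [->|s0] := eqVneq s 0%N; first by rewrite mulr0 sub0r lerN2; have := sqr_ge0 b; lra.
by rewrite expr_div_n sqr_sqrtr// mulrAC divfK ?pnatr_eq0//; lra.
Qed.

Let pos_exponent j t w (b : R) : 0 <= b -> b <= zscore j t w -> 0 <= S j t w ->
  b ^+ 2 <= b / Num.sqrt (N j t w)%:R * S j t w.
Proof.
move=> b0 bz S0; rewrite expr2 -mulrA ler_wpM2l// (le_trans bz)//.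
by rewrite /zscore ger0_norm// mulrC.
Qed.

Let neg_exponent j t w (b : R) : 0 <= b -> b <= zscore j t w -> S j t w < 0 ->
  b ^+ 2 <= (- b) / Num.sqrt (N j t w)%:R * S j t w.
Proof.
move=> b0 bz S0; rewrite mulNr mulNr -mulrN expr2 -mulrA ler_wpM2l// (le_trans bz)//.
by rewrite /zscore ltr0_norm// mulrC.
Qed.

Let split_sign j t : d.-measurable [set w | 0 <= S j t w].
Proof. by apply: (mpast (t := t)); exact: past_dev_ge0. Qed.

Let sign_union j t (A : set Om) :
  A `<=` (A `&` [set w | 0 <= S j t w]) `|` (A `&` ~` [set w | 0 <= S j t w]).
Proof. by rewrite -setIUr setUv setIT. Qed.

Let chernoff_pulls j (lam : R) s (A : nat -> set Om) (b : R) T :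
  (forall t, measurable (A t)) ->
  (forall t w, A t w -> [/\ x t.+1 w = j, N j t w = s & b <= lam * S j t w]) ->
  \sum_(t < T) pr (A t) <= expR (lam ^+ 2 / 2 * s%:R - b).
Proof.
move=> mA AE; rewrite -lee_fin -sumEFin; under eq_bigr do rewrite -prE//.
exact: (pulls_tail subg run _ mA AE).
Qed.

(** Chernoff with the exponent [b / sqrt s], optimal when [j] has been pulled [s]
   times.  For [s = 0] both [zscore] and the exponent are [0]. *)
Lemma zscore_pulls_tail j s (b : R) T (A : nat -> set Om) : 0 <= b ->
  (forall t, measurable (A t)) ->
  (forall t w, A t w -> [/\ x t.+1 w = j, N j t w = s & b <= zscore j t w]) ->
  \sum_(t < T) pr (A t) <= 2 * expR (- (b ^+ 2 / 2)).
Proof.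
move=> b0 mA AE.
have mAp t : measurable (A t `&` [set w | 0 <= S j t w]) by apply: measurableI.
have mAn t : measurable (A t `&` ~` [set w | 0 <= S j t w]).
  by apply: measurableI => //; exact: measurableC.
apply: (@le_trans _ _ (\sum_(t < T) (pr (A t `&` [set w | 0 <= S j t w]) +
   pr (A t `&` ~` [set w | 0 <= S j t w])))).
  by apply: ler_sum => t _; apply: pr_le_setU => //; exact: sign_union.
rewrite big_split/= (_ : 2 * _ = expR (- (b ^+ 2 / 2)) + expR (- (b ^+ 2 / 2))); last by ring.
apply: lerD.
  apply: (@le_trans _ _ (expR ((b / Num.sqrt s%:R) ^+ 2 / 2 * s%:R - b ^+ 2))); last first.
    by rewrite ler_expR lam_sqr.
  apply: (chernoff_pulls (j := j) _ mAp) => t w [/AE[-> Ns bz] S0]; split=> //.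
  by rewrite -Ns pos_exponent.
apply: (@le_trans _ _ (expR (((- b) / Num.sqrt s%:R) ^+ 2 / 2 * s%:R - b ^+ 2))); last first.
  by rewrite ler_expR -(sqrrN b) lam_sqr.
apply: (chernoff_pulls (j := j) _ mAn) => t w [/AE[-> Ns bz] /negP].
by rewrite -ltNge => S0; split=> //; rewrite -Ns neg_exponent.
Qed.

(** The counterpart at a fixed round, used only for the capped band, where no
   pull of arm [j] is available to charge. *)
Lemma zscore_time_tail j s (b : R) t (A : set Om) : 0 <= b -> measurable A ->
  (forall w, A w -> N j t w = s /\ b <= zscore j t w) ->
  pr A <= 2 * expR (- (b ^+ 2 / 2)).
Proof.
move=> b0 mA AE.
have mAp : measurable (A `&` [set w | 0 <= S j t w]) by apply: measurableI.
have mAn : measurable (A `&` ~` [set w | 0 <= S j t w]).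
  by apply: measurableI => //; exact: measurableC.
apply: (@le_trans _ _ (pr (A `&` [set w | 0 <= S j t w]) +
   pr (A `&` ~` [set w | 0 <= S j t w]))).
  by apply: pr_le_setU => //; exact: sign_union.
rewrite (_ : 2 * _ = expR (- (b ^+ 2 / 2)) + expR (- (b ^+ 2 / 2))); last by ring.
apply: lerD.
  apply: (@le_trans _ _ (expR ((b / Num.sqrt s%:R) ^+ 2 / 2 * s%:R - b ^+ 2))); last first.
    by rewrite ler_expR lam_sqr.
  rewrite -lee_fin -prE//.
  apply: (time_tail subg run mAp (j := j) (t := t)) => w [/AE[Ns bz] S0]; split=> //.
  by rewrite -Ns pos_exponent.
apply: (@le_trans _ _ (expR (((- b) / Num.sqrt s%:R) ^+ 2 / 2 * s%:R - b ^+ 2))); last first.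
  by rewrite ler_expR -(sqrrN b) lam_sqr.
rewrite -lee_fin -prE//.
apply: (time_tail subg run mAn (j := j) (t := t)) => w [/AE[Ns bz] /negP].
by rewrite -ltNge => S0; split=> //; rewrite -Ns neg_exponent.
Qed.

Let mpulled j t : measurable (pulled j t). Proof. exact: mx. Qed.
Let mcount_eq j t s : d.-measurable [set w | N j t w == s].
Proof. by apply: (mpast (t := t)); exact: past_count_eq. Qed.

Let split_count j T' t (A : set Om) : (t <= T')%N -> measurable A ->
  pr A = \sum_(s < T'.+1) pr (A `&` [set w | N j t w == s]).
Proof.
move=> tT mA.
have cellE (s : 'I_T'.+1) : (fun w => inord (N j t w) : 'I_T'.+1) @^-1` [set s] =
    [set w | N j t w == s].
  apply/seteqP; split=> w /=.
    by move=> <-; rewrite inordK// ltnS (leq_trans (pull_count_dataset_le _ _ _ _ _)).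
  by move=> /eqP ->; rewrite inord_val.
rewrite (@total_probability _ _ _ P _ (fun w => inord (N j t w) : 'I_T'.+1))//.
  by apply: eq_bigr => s _; rewrite cellE.
by move=> s; rewrite cellE.
Qed.

Let sum_by_count j T' (A : nat -> set Om) : (forall t, measurable (A t)) ->
  \sum_(t < T'.+1) pr (A t) =
  \sum_(s < T'.+1) \sum_(t < T'.+1) pr (A t `&` [set w | N j t w == s]).
Proof.
move=> mA; rewrite exchange_big/=; apply: eq_bigr => t _.
by apply: split_count => //; rewrite -ltnS.
Qed.

(** Each value of the pull count is attained by at most one pull. *)
Lemma early_pulls_le j T' l :
  \sum_(t < T'.+1) pr (pulled j t `&` ~` [set w | (l <= N j t w)%N]) <= l%:R.
Proof.
have mA t : measurable (pulled j t `&` ~` [set w | (l <= N j t w)%N]).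
  by apply: measurableI => //; apply: measurableC; apply: (mpast (t := t)); exact: past_count_ge.
rewrite (sum_by_count j _ mA).
apply: (@le_trans _ _ (\sum_(s < T'.+1) ((s < l)%N : nat)%:R)).
  apply: ler_sum => s _; have [sl|ls] := ltnP s l.
    rewrite (_ : true%:R = expR ((0 : R) ^+ 2 / 2 * s%:R - 0)); last first.
      by rewrite expr0n mul0r mul0r subr0 expR0.
    have mAs t := measurableI _ _ (mA t) (mcount_eq j t s).
    apply: (@chernoff_pulls j 0 s _ 0 T'.+1 mAs) => t w [[-> _] /eqP ->].
    by split=> //; rewrite mul0r.
  rewrite big1// => t _; rewrite (_ : _ `&` _ = set0) ?pr_set0//.
  by apply/seteqP; split=> w //= [[_ /negP]] /[swap] /eqP ->; rewrite ls.
rewrite -natr_sum ler_nat; elim: T'.+1 => [|n ih]; first by rewrite big_ord0.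
suff -> : (\sum_(s < n.+1) (s < l) = minn n.+1 l)%N by exact: geq_minr.
elim: n {ih} => [|n ih]; first by rewrite big_ord1; case: l {mA} => [|[|l]].
by rewrite big_ord_recr/= ih; lia.
Qed.

(** At the [s + 1]-st pull the deviation exceeds [s a] with probability at most
   [expR (- s a^2 / 2)]. *)
Lemma overestimated_pulls_le j T' (a : R) : 0 <= a ->
  \sum_(t < T'.+1) pr (pulled j t `&` ~` [set w | S j t w <= (N j t w)%:R * a]) <=
  \sum_(s < T'.+1) expR (- (s%:R * (a ^+ 2 / 2))).
Proof.
move=> a0.
have mA t : measurable (pulled j t `&` ~` [set w | S j t w <= (N j t w)%:R * a]).
  apply: measurableI => //; apply: measurableC; apply: (mpast (t := t)).
  exact: (past_sample_dev j (fun n => n%:R * a)).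
rewrite (sum_by_count j _ mA); apply: ler_sum => s _.
rewrite (_ : - _ = a ^+ 2 / 2 * s%:R - a * (s%:R * a)); last by field.
have mAs t := measurableI _ _ (mA t) (mcount_eq j t s).
apply: (@chernoff_pulls j a s _ _ T'.+1 mAs) => t w [[-> /negP]].
rewrite -ltNge => aS /eqP Ns; split=> //.
by rewrite ler_wpM2l// -Ns ltW.
Qed.

Section underestimated.
Variables (i j : 'I_K) (a : R) (T' kmax l : nat).
Hypotheses (a0 : 0 < a) (gap_ij : mu i - mu j = 3 * a).

Definition well_estimated t : set Om :=
  [set w | (l <= N j t w)%N] `&` [set w | S j t w <= (N j t w)%:R * a].

Let past_well t : sigma_data x phi t (well_estimated t).
Proof.
apply: (@measurableI _ (data_space x phi t)); first exact: past_count_ge.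
exact: (past_sample_dev j (fun n => n%:R * a)).
Qed.

Notation cell := (cell i T' kmax).

Let past_well_cell t sk : sigma_data x phi t (well_estimated t `&` cell t @^-1` [set sk]).
Proof.
apply: (@measurableI _ (data_space x phi t)); first exact: past_well.
exact: past_cell.
Qed.

(** The factor of [posterior_suboptimal_le] when [i] has been pulled [s] times
   with standardized deviation at most [k + 1]. *)
Definition cell_ratio (s k : nat) : R :=
  expR ((k.+1%:R ^+ 2 - s%:R * a ^+ 2 / 2) / s2).

Lemma posterior_cell_le t w (sk : 'I_T'.+1 * 'I_kmax.+1) : (t <= T')%N -> (sk.2 < kmax)%N ->
  (well_estimated t `&` cell t @^-1` [set sk]) w ->
  posterior t w j <= expR (- (l%:R * a ^+ 2 / s2)) + cell_ratio sk.1 sk.2 * posterior t w i.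
Proof.
move=> tT kmaxk [[lN devj] cellw].
apply: (le_trans (posterior_suboptimal_le sigma0 a0 gap_ij devj)).
have Ns := cell_count tT cellw.
apply: lerD.
  by rewrite ler_expR lerN2 ler_pM2r ?invr_gt0// ler_wpM2r ?sqr_ge0// ler_nat.
rewrite ler_wpM2r ?posterior_ge0// ler_expR ler_pM2r ?invr_gt0//.
rewrite -zscore_sqr Ns lerD2r lerXn2r ?nnegrE ?divr_ge0 ?sqrtr_ge0//.
exact/ltW/(cell_band_lt cellw).
Qed.

(** On each cell the ratio of the weights of [j] and [i] is a constant, so pulls
   of [j] can be charged to pulls of [i] with the same [n_i] and band, of which
   there are few.  The disjointness of the cells makes the error [expR _] count
   once per round rather than once per cell. *)
Lemma well_estimated_pulls_le :
  \sum_(t < T'.+1) pr (pulled j t `&` well_estimated t) <=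
  T'.+1%:R * expR (- (l%:R * a ^+ 2 / s2)) +
  \sum_(s < T'.+1) \sum_(k < kmax) cell_ratio s k * (2 * expR (- (k%:R ^+ 2 / 2))) +
  T'.+1%:R ^+ 2 * (2 * expR (- (kmax%:R ^+ 2 / 2))).
Proof.
set e := expR (- (l%:R * a ^+ 2 / s2)); set top := 2 * expR (- (kmax%:R ^+ 2 / 2)).
have mcell t sk : measurable (cell t @^-1` [set sk]) by apply: (mpast (t := t)); exact: past_cell.
have mwell t : measurable (well_estimated t) by apply: (mpast (t := t)); exact: past_well.
pose W t sk := well_estimated t `&` cell t @^-1` [set sk].
have mW t sk : measurable (W t sk) by exact: measurableI.
pose bound t (sk : 'I_T'.+1 * 'I_kmax.+1) : R :=
  if (sk.2 < kmax)%N then cell_ratio sk.1 sk.2 * pr (W t sk `&` pulled i t) else top.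
have per_cell t sk : (t <= T')%N ->
    pr (W t sk `&` pulled j t) <= e * pr (W t sk) + bound t sk.
  move=> tT; rewrite /bound; case: ifPn => [kk|].
    apply: arm_domination; rewrite ?expR_ge0 ?expR_gt0//; first exact: past_well_cell.
    by move=> w; exact: posterior_cell_le.
  rewrite -leqNgt => kk; rewrite -[leLHS]add0r lerD ?mulr_ge0 ?expR_ge0 ?pr_ge0//.
  apply: (@zscore_time_tail i sk.1 kmax%:R t) => //; first exact: measurableI.
  move=> w [[_ cellw] _]; rewrite (cell_count tT cellw); split=> //.
  by apply: le_trans (cell_band_ge cellw); rewrite ler_nat.
have decompose t : (t <= T')%N ->
    pr (pulled j t `&` well_estimated t) <= e + \sum_sk bound t sk.
  move=> tT; rewrite setIC.
  rewrite (@total_probability _ _ _ P _ (cell t))//; last exact: measurableI.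
  apply: (@le_trans _ _ (\sum_sk (e * pr (W t sk) + bound t sk))).
    by apply: ler_sum => sk _; rewrite setIAC; exact: per_cell.
  rewrite big_split/= lerD2r -mulr_sumr -total_probability//.
  by rewrite ler_piMr ?expR_ge0// pr_le1.
have bound_sum (sk : 'I_T'.+1 * 'I_kmax.+1) : \sum_(t < T'.+1) bound t sk <=
    if (sk.2 < kmax)%N then cell_ratio sk.1 sk.2 * (2 * expR (- (sk.2%:R ^+ 2 / 2)))
    else T'.+1%:R * top.
  rewrite /bound; case: ifPn => kk; last by rewrite sumr_const card_ord mulr_natl.
  rewrite -mulr_sumr ler_wpM2l ?expR_ge0//.
  pose A t := if (t <= T')%N then W t sk `&` pulled i t else set0.
  rewrite (eq_bigr (fun t : 'I_T'.+1 => pr (A t))); last first.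
    by move=> t _; rewrite /A -ltnS ltn_ord.
  apply: (@zscore_pulls_tail i sk.1 sk.2%:R T'.+1 A) => //.
    by move=> t; rewrite /A; case: ifP => // _; exact: measurableI.
  move=> t w; rewrite /A; case: ifP => // tT [[_ cellw] ->]; split=> //.
    exact: cell_count cellw.
  exact: cell_band_ge cellw.
apply: (@le_trans _ _ (\sum_(t < T'.+1) (e + \sum_sk bound t sk))).
  by apply: ler_sum => t _; apply: decompose; rewrite -ltnS.
rewrite big_split/= sumr_const card_ord -[e *+ _]mulr_natl -addrA lerD2l exchange_big/=.
apply: (le_trans (ler_sum _ (fun sk _ => bound_sum sk))).
rewrite -(pair_bigA _ (fun (s : 'I_T'.+1) (k : 'I_kmax.+1) => if (k < kmax)%N
  then cell_ratio s k * (2 * expR (- (k%:R ^+ 2 / 2))) else T'.+1%:R * top))/=.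
rewrite (eq_bigr (fun s : 'I_T'.+1 =>
   \sum_(k < kmax) cell_ratio s k * (2 * expR (- (k%:R ^+ 2 / 2))) + T'.+1%:R * top)).
  by rewrite big_split/= sumr_const card_ord -[_ *+ T'.+1]mulr_natl mulrA -expr2.
move=> s _; rewrite big_ord_recr/= ltnn; congr (_ + _).
by apply: eq_bigr => k _; rewrite ltn_ord.
Qed.

(** A pull of [j] is early, or happens while [j] is overestimated, or while [j]
   is well estimated. *)
Lemma expected_pulls_le :
  \sum_(t < T'.+1) pr (pulled j t) <=
  l%:R + \sum_(s < T'.+1) expR (- (s%:R * (a ^+ 2 / 2))) +
  T'.+1%:R * expR (- (l%:R * a ^+ 2 / s2)) +
  \sum_(s < T'.+1) \sum_(k < kmax) cell_ratio s k * (2 * expR (- (k%:R ^+ 2 / 2))) +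
  T'.+1%:R ^+ 2 * (2 * expR (- (kmax%:R ^+ 2 / 2))).
Proof.
apply: (@le_trans _ _ (\sum_(t < T'.+1) (
  pr (pulled j t `&` ~` [set w | (l <= N j t w)%N]) +
  pr (pulled j t `&` ~` [set w | S j t w <= (N j t w)%:R * a]) +
  pr (pulled j t `&` well_estimated t)))).
  apply: ler_sum => t _.
  have mc : measurable [set w | (l <= N j t w)%N].
    by apply: (mpast (t := t)); exact: past_count_ge.
  have md : measurable [set w | S j t w <= (N j t w)%:R * a].
    by apply: (mpast (t := t)); exact: (past_sample_dev j (fun n => n%:R * a)).
  have mA := measurableI _ _ (mpulled j t) (measurableC mc).
  have mB := measurableI _ _ (mpulled j t) (measurableC md).
  have mC := measurableI _ _ (mpulled j t) (measurableI _ _ mc md).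
  have mAB := measurableU _ _ mA mB.
  apply: (@le_trans _ _ (pr (pulled j t `&` ~` [set w | (l <= N j t w)%N] `|`
     pulled j t `&` ~` [set w | S j t w <= (N j t w)%:R * a]) +
     pr (pulled j t `&` well_estimated t))); last by rewrite lerD2r; exact: pr_setU_le.
  apply: pr_le_setU => //.
  by rewrite -!setIUr -setCI setUC setUv setIT.
rewrite !big_split/=.
apply: (le_trans (lerD (lerD (early_pulls_le j T' l)
  (overestimated_pulls_le j T' (ltW a0))) well_estimated_pulls_le)).
by rewrite !addrA.
Qed.

End underestimated.

End pull_bound.

(** * Bounds on the exponential sums *)

Section exponential_sums.
Set Implicit Arguments.
Unset Strict Implicit.
Context {R : realType}.

Lemma sum_expR_le (c : R) n : 0 < c -> \sum_(s < n) expR (- (s%:R * c)) <= 1 + c^-1.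
Proof.
move=> c0; have c'0 : 0 < 1 + c by lra.
have telescope s : expR (- (s%:R * c)) <=
    (1 + c^-1) * (expR (- (s%:R * c)) - expR (- (s.+1%:R * c))).
  have -> : s.+1%:R * c = s%:R * c + c by rewrite -natr1; ring.
  rewrite opprD expRD -{2}[expR (- (s%:R * c))]mulr1 -mulrBr.
  rewrite mulrCA ler_peMr ?expR_ge0//.
  have h : (1 + c) * expR (- c) <= 1.
    by rewrite expRN ler_pdivrMr ?expR_gt0// mul1r expR_ge1Dx.
  have -> : 1 + c^-1 = (1 + c) / c by field; rewrite gt_eqF.
  by rewrite mulrAC ler_pdivlMr// mul1r; lra.
apply: (@le_trans _ _ ((1 + c^-1) * (1 - expR (- (n%:R * c))))); last first.
  have := expR_gt0 (- (n%:R * c)); rewrite ler_piMr ?addr_ge0 ?invr_ge0 ?(ltW c0)//; lra.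
elim: n => [|n ih]; first by rewrite big_ord0 mul0r oppr0 expR0 subrr mulr0.
by rewrite big_ord_recr/=; have := telescope n; lra.
Qed.

Definition band_constant (sigma : R) : R := 4 * expR (1 + 2 / (1 - sigma ^- 2)).

(** The Gaussian tail [expR (- k^2 / 2)] beats the growth
   [expR (k^2 / (2 sigma^2))] exactly because [1 < sigma]. *)
Lemma band_sum_le (sigma : R) n : 1 < sigma ->
  \sum_(k < n) expR (k.+1%:R ^+ 2 / (2 * sigma ^+ 2)) * (2 * expR (- (k%:R ^+ 2 / 2)))
    <= band_constant sigma.
Proof.
move=> sigma1; set al := 1 - sigma ^- 2; set b := 1 + 2 / al.
have s2 : 1 < sigma ^+ 2 by rewrite exprn_egt1.
have si0 : 0 < sigma ^- 2 by rewrite invr_gt0; lra.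
have al0 : 0 < al by rewrite subr_gt0 invf_lt1//; lra.
apply: (@le_trans _ _ (\sum_(k < n) (2 * expR b) * expR (- (k%:R * 1)))); last first.
  rewrite -mulr_sumr /band_constant -/al -/b.
  have := @sum_expR_le 1 n ltr01; rewrite invr1 => h.
  by have := expR_gt0 b; nra.
apply: ler_sum => k _; rewrite mulrCA -expRD -mulrA -expRD ler_pM2l// ler_expR.
have -> : k.+1%:R ^+ 2 / (2 * sigma ^+ 2) = (k%:R + 1) ^+ 2 * sigma ^- 2 / 2.
  by rewrite -natr1 invfM mulrA mulrAC.
(* completing the square: [2 k <= al k^2 / 2 + 2 / al] *)
have : 0 <= (al * k%:R - 2) ^+ 2 / al by rewrite divr_ge0 ?sqr_ge0// ltW.
have -> : (al * k%:R - 2) ^+ 2 / al = al * k%:R ^+ 2 - 4 * k%:R + 4 / al.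
  by field; rewrite gt_eqF.
have -> : sigma ^- 2 = 1 - al by rewrite /al; ring.
have k0 : 0 <= k%:R :> R by [].
have : al * k%:R >= 0 by rewrite mulr_ge0// ltW.
by rewrite /b; lra.
Qed.

Lemma ln_max_le (T D : R) : 1 <= T -> 0 < D -> ln (Num.max 1 (T * D ^+ 2)) <= ln T + D ^+ 2.
Proof.
move=> T1 D0; have T0 : 0 < T by lra.
have lnT0 : 0 <= ln T by rewrite ln_ge0.
have D2 : 0 < D ^+ 2 by rewrite exprn_gt0.
rewrite /Num.max; case: ifP => _; last by rewrite ln1 addr_ge0// ltW.
by rewrite lnM ?posrE// lerD2l ltW// ln_sublinear.
Qed.

End exponential_sums.

Section pulls_of_suboptimal_arm.
Set Implicit Arguments.
Unset Strict Implicit.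
Context {R : realType}.

Definition pulls_constant (sigma : R) : R :=
  22 + 18 * sigma ^+ 2 + band_constant sigma * (1 + 36 * sigma ^+ 2).

Lemma pulls_constant_ge1 (sigma : R) : 1 <= pulls_constant sigma.
Proof.
have := sqr_ge0 sigma; have : 0 <= band_constant sigma.
  by rewrite mulr_ge0 ?expR_ge0.
by rewrite /pulls_constant; nra.
Qed.

(** The cap [kmax = 2 T] makes the contribution of the capped bands at most
   [1]. *)
Lemma sqr_expRN_le (n : nat) : n%:R ^+ 2 * (2 * expR (- ((2 * n)%N%:R ^+ 2 / 2))) <= 1 :> R.
Proof.
rewrite expRN natrM; have := expR_ge1Dx ((2 * n%:R) ^+ 2 / 2 : R).
set e := expR _ => h; have e0 : 0 < e by exact: expR_gt0.
by rewrite mulrA ler_pdivrMr// mul1r; lra.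
Qed.

Context {K : nat} (sigma : R) (sigma1 : 1 < sigma)
  (nu : 'I_K -> real_law R) (mu : 'I_K -> R)
  d (Om : measurableType d) (P : probability Om R)
  (x : nat -> Om -> 'I_K) (phi : nat -> Om -> R).
Hypothesis subg : forall j, one_subgaussian (nu j) (mu j).
Hypothesis run : mints_run sigma [set: 'rV[R]_K] uniform_prior nu P x phi.

Lemma suboptimal_pulls_le i j (D : R) T : 0 < D -> mu i - mu j = D -> (0 < T)%N ->
  \sum_(t < T) pr P (pulled x j t) <=
  pulls_constant sigma * (1 + (1 + ln (Num.max 1 (T%:R * D ^+ 2))) / D ^+ 2).
Proof.
case: T => // T' D0 Dij _; set T := T'.+1.
have sigma0 : 0 < sigma by exact: lt_trans ltr01 sigma1.
set m := Num.max _ _; set Lm := ln m; set s2 := 2 * sigma ^+ 2.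
have s2_gt0 : 0 < s2 by rewrite mulr_gt0// exprn_gt0.
have m1 : 1 <= m by rewrite le_max lexx.
have Lm0 : 0 <= Lm by rewrite ln_ge0.
pose a := D / 3; have a0 : 0 < a by rewrite divr_gt0.
have a2 : 0 < a ^+ 2 by rewrite exprn_gt0.
(* the number of pulls of [j] after which [expR (- l a^2 / s2) <= 1 / m] *)
pose l := (Num.truncn (s2 * Lm / a ^+ 2)).+1.
have lup : l%:R <= 1 + s2 * Lm / a ^+ 2.
  rewrite /l -natr1 addrC lerD2l truncn_le// divr_ge0 ?mulr_ge0// ltW//.
have llo : s2 * Lm / a ^+ 2 <= l%:R by exact/ltW/truncnS_gt.
have Dij3 : mu i - mu j = 3 * a by rewrite Dij /a; field.
have := @expected_pulls_le _ _ _ sigma0 _ _ _ _ _ _ _ subg run i j a T' (2 * T)%N l a0 Dij3.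
move=> /le_trans; apply; rewrite -/T -/s2.
have D2 : 0 < D ^+ 2 by rewrite exprn_gt0.
set iD := (D ^+ 2)^-1; have iD0 : 0 < iD by rewrite invr_gt0.
have h1 : l%:R <= 1 + 18 * sigma ^+ 2 * Lm * iD.
  rewrite (le_trans lup)// lerD2l /a /s2 /iD le_eqVlt; apply/orP; left; apply/eqP.
  by field; rewrite gt_eqF.
have h2 : \sum_(s < T) expR (- (s%:R * (a ^+ 2 / 2))) <= 1 + 18 * iD.
  apply: (le_trans (sum_expR_le _ _)); first by rewrite divr_gt0.
  rewrite lerD2l /a /iD le_eqVlt; apply/orP; left; apply/eqP.
  by field; rewrite gt_eqF.
have h3 : T%:R * expR (- (l%:R * a ^+ 2 / s2)) <= iD.
  have : expR (- (l%:R * a ^+ 2 / s2)) <= m^-1.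
    rewrite -[m]lnK ?posrE; last by lra.
    rewrite -expRN ler_expR lerN2 -/Lm ler_pdivlMr// mulrC -ler_pdivrMr//.
  move=> /(ler_wpM2l (ler0n R T)) /le_trans; apply.
  rewrite ler_pdivrMr; last by lra.
  by rewrite mulrC /iD ler_pdivlMr// /m le_max lexx orbT.
have h4 : \sum_(s < T) \sum_(k < 2 * T)
   cell_ratio sigma a s k * (2 * expR (- (k%:R ^+ 2 / 2))) <=
   band_constant sigma * (1 + 36 * sigma ^+ 2 * iD).
  pose c := a ^+ 2 / 2 / s2.
  have -> : 36 * sigma ^+ 2 * iD = c^-1.
    by rewrite /c /a /s2 /iD; field; rewrite !gt_eqF.
  apply: (@le_trans _ _ (\sum_(s < T) (band_constant sigma * expR (- (s%:R * c))))).
    apply: ler_sum => s _; apply: (@le_trans _ _ (\sum_(k < 2 * T)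
      (expR (k.+1%:R ^+ 2 / s2) * (2 * expR (- (k%:R ^+ 2 / 2)))) * expR (- (s%:R * c)))).
      apply: ler_sum => k _; rewrite /cell_ratio -/s2 mulrBl expRD.
      by rewrite mulrAC (_ : s%:R * a ^+ 2 / 2 / s2 = s%:R * c)// /c !mulrA.
    by rewrite -mulr_suml ler_wpM2r ?expR_ge0// band_sum_le.
  rewrite -mulr_sumr ler_wpM2l ?mulr_ge0 ?expR_ge0//.
  by apply: sum_expR_le; rewrite !divr_gt0.
have h5 := sqr_expRN_le T.
apply: (le_trans (lerD (lerD (lerD (lerD h1 h2) h3) h4) h5)).
have B0 : 0 <= band_constant sigma by rewrite mulr_ge0 ?expR_ge0.
have sg2 := sqr_ge0 sigma.
rewrite /pulls_constant -/iD.
have u0 : 0 <= Lm * iD by rewrite mulr_ge0// ltW.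
have Bs0 := mulr_ge0 B0 sg2.
have := mulr_ge0 sg2 (ltW iD0); have := mulr_ge0 B0 (ltW iD0).
have := mulr_ge0 Bs0 (ltW iD0); have := mulr_ge0 sg2 u0.
have := mulr_ge0 B0 u0; have := mulr_ge0 Bs0 u0.
clear -B0 sg2 iD0 u0 Bs0; lra.
Qed.

End pulls_of_suboptimal_arm.

(** * Regret *)

Section regret_arithmetic.
Set Implicit Arguments.
Unset Strict Implicit.
Context {R : realType}.
Implicit Types (T D : R).

Let ln2_gt0 : 0 < ln 2 :> R. Proof. by rewrite ln_gt0// ltr1n. Qed.

Lemma gap_dependent_term_le T D : 2 <= T -> 0 < D ->
  (1 + ln (Num.max 1 (T * D ^+ 2))) / D <= (1 + (ln 2)^-1) * (ln T / D) + D.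
Proof.
move=> T2 D0; rewrite ler_pdivrMr// mulrDl -mulrA divfK ?gt_eqF//.
have T0 : 0 < T by lra.
have h : 1 <= (ln 2)^-1 * ln T.
  by rewrite mulrC ler_pdivlMr// mul1r ler_ln ?posrE.
by have := @ln_max_le R T D ltac:(lra) D0; rewrite -expr2; lra.
Qed.

(** The right-hand side is a multiple of [ln K / d0], where
   [d0 = sqrt (K ln K / T)].  Write [D = r d0] and multiply by [D]: the right is
   multiplied by [r], whereas the left gains at most [2 ln r]. *)
Lemma gap_free_term_le (K : nat) T D : (1 < K)%N -> 1 <= T ->
  Num.sqrt (K%:R * ln K%:R / T) < D ->
  (1 + ln (Num.max 1 (T * D ^+ 2))) / D <=
    (2 + 3 / ln 2) * (Num.sqrt (K%:R * T * ln K%:R) / K%:R).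
Proof.
move=> K1 T1 D0D; set k : R := K%:R; set L : R := ln k.
have k2 : 2 <= k by rewrite ler_nat.
have T0 : 0 < T by lra.
have k0 : 0 < k by lra.
have L2 : ln 2 <= L by rewrite ler_ln ?posrE.
have L0 : 0 < L by apply: lt_le_trans L2.
have Lk : L <= k by exact/ltW/ln_sublinear.
set d0 := Num.sqrt _ in D0D.
have y0 : 0 < k * L / T by rewrite divr_gt0 ?mulr_gt0.
have d00 : 0 < d0 by rewrite sqrtr_gt0.
have d0sq : d0 ^+ 2 = k * L / T by rewrite sqr_sqrtr// ltW.
have D0 : 0 < D by apply: lt_trans D0D.
set q := _ / k.
have q0 : 0 <= q by rewrite divr_ge0 ?sqrtr_ge0// ltW.
have qd0 : q * d0 = L.
  have kTL : 0 <= k * T * L by rewrite !mulr_ge0// ltW.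
  rewrite /q /d0 mulrAC -sqrtrM// (_ : k * T * L * (k * L / T) = (k * L) ^+ 2); last first.
    by field; rewrite gt_eqF.
  by rewrite sqrtr_sqr ger0_norm ?mulr_ge0 ?(ltW k0) ?(ltW L0)// mulrAC divff ?mul1r// gt_eqF.
pose r := D / d0.
have r1 : 1 <= r by rewrite ler_pdivlMr// mul1r ltW.
have r0 : 0 < r by lra.
have Dr : D = r * d0 by rewrite /r divfK// gt_eqF.
have TD : T * D ^+ 2 = r ^+ 2 * (k * L).
  by rewrite Dr exprMn d0sq; field; rewrite gt_eqF.
have kr1 : 1 <= r * k by nra.
have lnm : ln (Num.max 1 (T * D ^+ 2)) <= 2 * (r + L).
  apply: (@le_trans _ _ (ln ((r * k) ^+ 2))).
    have max0 : 0 < Num.max 1 (T * D ^+ 2) by rewrite lt_max ltr01.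
    have rk0 : 0 < (r * k) ^+ 2 by rewrite exprn_gt0// mulr_gt0.
    rewrite ler_ln// {max0 rk0}.
    rewrite ge_max exprn_ege1//= TD [(r * k) ^+ 2]exprMn ler_wpM2l ?sqr_ge0// expr2.
    by rewrite ler_wpM2l// ltW.
  have rk0 : 0 < r * k by rewrite mulr_gt0.
  rewrite lnXn// [ln (r * k)]lnM// -/L.
  by have := ln_sublinear r0; lra.
have qD : q * D = r * L by rewrite {1}Dr mulrCA qd0.
rewrite ler_pdivrMr// -(mulrA _ q) qD.
have rL2 : r <= r * L / ln 2.
  by rewrite ler_pdivlMr// ler_wpM2l// ltW.
have rLL : L <= r * L by rewrite ler_peMl// ltW.
have -> : (2 + 3 / ln 2) * (r * L) = 2 * (r * L) + 3 * (r * L / ln 2) by ring.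
by lra.
Qed.

End regret_arithmetic.

Section regret_decomposition.
Set Implicit Arguments.
Unset Strict Implicit.
Context {R : realType} {K : nat} (mu : 'I_K -> R).

Lemma gap_ge0 j : 0 <= gap mu j.
Proof. by rewrite subr_ge0 bigmax_ge_id. Qed.

Lemma best_arm : (0 < K)%N -> exists i, forall j, mu i - mu j = gap mu j.
Proof.
move=> K0; have [i _ iP] := @arg_maxP _ R _ (Ordinal K0) xpredT mu isT.
exists i => j; rewrite /gap; congr (_ - _); apply: le_anti; apply/andP; split.
  exact: le_bigmax.
by apply: bigmax_le => [|k _]; exact: iP.
Qed.

Context d (Om : measurableType d) (P : probability Om R) (x : nat -> Om -> 'I_K).
Hypothesis mx : forall t j, measurable (x t.+1 @^-1` [set j]).

Lemma expected_regretE T :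
  ('E_P[regret mu x T] = (\sum_j gap mu j * \sum_(t < T) pr P (pulled x j t))%:E)%E.
Proof.
have regretE w : (regret mu x T w)%:E =
    (\sum_(t < T) \sum_j (gap mu j)%:E * (\1_(pulled x j t) w)%:E)%E.
  rewrite /regret big_add1/= big_mkord -sumEFin; apply: eq_bigr => t _.
  rewrite (bigD1 (x t.+1 w))//= big1 ?adde0.
    by rewrite indicE mem_set// mule1.
  by move=> j /eqP xj; rewrite indicE memNset ?mule0// => jx; exact: xj.
have mI j t : measurable_fun setT (fun w => (\1_(pulled x j t) w)%:E : \bar R).
  by apply/measurable_EFinP/measurable_indic; exact: mx.
have mF j t : measurable_fun setT (fun w => (gap mu j)%:E * (\1_(pulled x j t) w)%:E)%E.
  exact: measurable_funeM.
have F0 j t w : (0 <= (gap mu j)%:E * (\1_(pulled x j t) w)%:E)%E.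
  by rewrite mule_ge0// lee_fin ?gap_ge0.
rewrite unlock; under eq_integral do rewrite regretE.
rewrite ge0_integral_sum//; last 2 first.
- by move=> t; apply: emeasurable_sum => j; exact: mF.
- by move=> t w _; apply: sume_ge0 => j _; exact: F0.
have intI j t : (\int[P]_w ((gap mu j)%:E * (\1_(pulled x j t) w)%:E) =
    (gap mu j * pr P (pulled x j t))%:E)%E.
  rewrite ge0_integralZl//; last by rewrite lee_fin gap_ge0.
  have mp : measurable (pulled x j t) by exact: mx.
  by rewrite integral_indic// setIT EFinM; congr (_ * _)%E; exact: prE.
rewrite (eq_bigr (fun t : 'I_T => (\sum_j gap mu j * pr P (pulled x j t))%:E)); last first.
  move=> t _; rewrite ge0_integral_sum//.
  by rewrite -sumEFin; apply: eq_bigr => j _; exact: intI.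
rewrite sumEFin exchange_big/=; congr EFin.
by apply: eq_bigr => j _; rewrite mulr_sumr.
Qed.

Lemma sum_pulled t : \sum_j pr P (pulled x j t) = 1.
Proof.
have := @total_probability _ _ _ P _ (x t.+1) setT measurableT (mx t).
under eq_bigr do rewrite setTI.
by move=> <-; rewrite /pr probability_setT.
Qed.

End regret_decomposition.

Theorem theorem4p1 (R : realType) (sigma : R) (hsigma : 1 < sigma) :
  exists2 C : R, 0 < C &
    forall (K : nat) (nu : 'I_K -> real_law R) (mu : 'I_K -> R)
           (d : measure_display) (Om : measurableType d) (P : probability Om R)
           (x : nat -> Om -> 'I_K) (phi : nat -> Om -> R),
      (0 < K)%N ->
      (forall j : 'I_K, has_mean (nu j) (mu j)) ->
      (forall j : 'I_K, one_subgaussian (nu j) (mu j)) ->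
      mints_run sigma [set: 'rV[R]_K] uniform_prior nu P x phi ->
      forall T : nat, (0 < T)%N ->
        ('E_P[regret mu x T] <=
          (C * (Num.min (\sum_(j < K | 0 < gap mu j) ln (T%:R : R) / gap mu j)
                        (Num.sqrt (K%:R * T%:R * ln (K%:R : R)))
                + \sum_(j < K) gap mu j))%:E)%E.
Proof.
pose B := pulls_constant sigma; have B1 : 1 <= B := pulls_constant_ge1 sigma.
have B0 : 0 <= B by exact: le_trans ler01 B1.
pose c2 : R := (ln 2)^-1; have c20 : 0 < c2 by rewrite invr_gt0 ln_gt0// ltr1n.
have Bc0 : 0 <= B * c2 by rewrite mulr_ge0// ltW.
pose C := 1 + 2 * B + B * (1 + c2) + B * (2 + 3 * c2).
exists C; first by rewrite /C; lra.
move=> K nu mu d Om P x phi K0 _ subg run T T0.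
have mx := mints_measurable_arm run.
rewrite expected_regretE// lee_fin.
pose n j := \sum_(t < T) pr P (pulled x j t).
have n0 j : 0 <= n j by apply: sumr_ge0 => t _; exact: pr_ge0.
have nsum : \sum_j n j = T%:R.
  rewrite exchange_big/= (eq_bigr (fun _ => 1)) ?sumr_const ?card_ord//.
  by move=> t _; exact: sum_pulled.
have nT j : n j <= T%:R.
  by rewrite -nsum (bigD1 j)//= lerDl sumr_ge0.
have [i iP] := best_arm mu K0.
have nB j : 0 < gap mu j ->
    gap mu j * n j <= B * (gap mu j + (1 + ln (Num.max 1 (T%:R * gap mu j ^+ 2))) / gap mu j).
  move=> g0; have := suboptimal_pulls_le hsigma subg run (i := i) (j := j) g0 (iP j) T0.
  move=> /(ler_wpM2l (ltW g0)) /le_trans; apply; rewrite -/B le_eqVlt; apply/orP; left.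
  by apply/eqP; field; rewrite gt_eqF.
set G := \sum_(j < K) gap mu j.
have G0 : 0 <= G by apply: sumr_ge0 => j _; exact: gap_ge0.
set S1 := \sum_(j < K | 0 < gap mu j) _; set S2 := Num.sqrt _.
have T1 : 1 <= T%:R :> R by rewrite ler1n.
have S10 : 0 <= S1 by apply: sumr_ge0 => j g0; rewrite divr_ge0 ?ln_ge0// ltW.
have S20 : 0 <= S2 := sqrtr_ge0 _.
suff [h1 h2] : \sum_j gap mu j * n j <= B * (1 + c2) * S1 + (1 + 2 * B) * G /\
    \sum_j gap mu j * n j <= (1 + B * (2 + 3 * c2)) * S2 + B * G.
  rewrite /Num.min; case: ifP => _.
    by apply: (le_trans h1); rewrite (mulrDr C) lerD// ler_wpM2r// /C; lra.
  by apply: (le_trans h2); rewrite (mulrDr C) lerD// ler_wpM2r// /C; lra.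
split.
  rewrite /S1 /G [\sum_(j < K | 0 < gap mu j) _]big_mkcond/= !mulr_sumr -big_split/=; apply: ler_sum => j _.
  have [g0|] := ltP 0 (gap mu j); last first.
    move=> /(conj (gap_ge0 mu j)) /andP/le_anti <-.
    by rewrite mul0r !mulr0 addr0.
  (* For [T = 1] the logarithm vanishes and the single pull costs [gap mu j]. *)
  have [T2|] := leqP 2 T; last first.
    case: T T0 {nsum T1 S1 S10 S2 S20} n n0 nT nB => [//|[|//]] _ n n0 nT nB _.
    rewrite ln1 mul0r mulr0 add0r mulrC ler_wpM2r ?(ltW g0)//.
    by rewrite (le_trans (nT j))//; nra.
  apply: (le_trans (nB j g0)).
  have := @gap_dependent_term_le R T%:R _ ltac:(by rewrite ler_nat) g0.
  by rewrite -/c2; nra.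
have c230 : 0 <= 2 + 3 * c2 by lra.
(* For [K = 1] the claimed bound is [0], and so is the only gap. *)
have [K2|K1] := leqP 2 K; last first.
  have gap0 j : gap mu j = 0.
    rewrite -(iP j) (_ : i = j) ?subrr//; apply: val_inj.
    by case: i j {iP} => [[|i] ?] [[|j] ?] //=; lia.
  rewrite big1 => [|j _]; last by rewrite gap0 mul0r.
  by rewrite addr_ge0// mulr_ge0// addr_ge0// mulr_ge0.
set k : R := K%:R; set D0 := Num.sqrt (k * ln k / T%:R).
have k0 : 0 < k by rewrite ltr0n.
have Tpos : 0 < T%:R :> R by rewrite ltr0n.
have lnk0 : 0 <= ln k by rewrite ln_ge0// ler1n.
have D00 : 0 <= D0 by exact: sqrtr_ge0.
have D0T : D0 * T%:R = S2.
  rewrite /D0 -[X in _ * X](ger0_norm (ltW Tpos)) -sqrtr_sqr -sqrtrM; last first.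
    by rewrite divr_ge0 ?mulr_ge0 ?(ltW k0) ?(ltW Tpos).
  by rewrite /S2 -/k; congr Num.sqrt; field; rewrite gt_eqF.
have armwise j : gap mu j * n j <=
    D0 * n j + (B * gap mu j + B * (2 + 3 * c2) * (S2 / k)).
  have rest0 : 0 <= B * gap mu j + B * (2 + 3 * c2) * (S2 / k).
    by rewrite addr_ge0 ?mulr_ge0 ?gap_ge0 ?invr_ge0 ?(ltW k0).
  have [small|large] := leP (gap mu j) D0.
    by rewrite -[leLHS]addr0 lerD// ler_wpM2r.
  have g0 : 0 < gap mu j by exact: le_lt_trans large.
  apply: (le_trans (nB j g0)); rewrite mulrDr -[leLHS]add0r lerD ?mulr_ge0// lerD2l -mulrA.
  by rewrite ler_wpM2l// -/c2 gap_free_term_le.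
apply: (le_trans (ler_sum _ (fun j _ => armwise j))).
rewrite !big_split/= -!mulr_sumr nsum D0T sumr_const card_ord -/G.
rewrite -[k^-1 *+ K]mulr_natr mulVf ?gt_eqF// mulr1; lra.
Qed.
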